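(* Let $\psi\in\mathbb C^N$ be a fixed unit vector, let $(U_t)_{t\ge0}$ be the unitary Brownian motion with $U_0=I$, and put $\psi_t=U_t\psi$. Let $A$ be a fixed observable, i.e. a self-adjoint $N\times N$ complex matrix. Then for all $t\ge0$ $$\mathbb E\langle\psi_t,A\psi_t\rangle=\Big(\langle\psi,A\psi\rangle-\frac{\mathrm{Tr}(A)}{N}\Big)e^{-t}+\frac{\mathrm{Tr}(A)}{N}.$$
   Context: Hermitian Brownian motion $(H_t)_{t\ge0}$: the continuous centered Gaussian process in the real vector space of $N\times N$ Hermitian matrices, with $H_0=0$, such that $\mathbb E[\mathrm{T}(A,H_s)\,\mathrm{T}(B,H_t)]=\min(s,t)\,\mathrm{T}(A,B)$ for all Hermitian $A,B$, where $\mathrm{T}(A,B)=N\,\mathrm{Tr}(AB)$. The unitary Brownian motion started at $I$ is the solution of the It\^o stochastic differential equation $dU_t=i(dH_t)U_t-\frac12U_t\,dt$, $U_0=I$; it takes values in the group of $N\times N$ unitary matrices. In the claim, $\langle\cdot,\cdot\rangle$ is the standard Hermitian inner product on $\mathbb C^N$. *)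

(* Defs.v *)
From HB Require Import structures.
From mathcomp Require Import all_boot all_order all_algebra.
From mathcomp Require Import all_classical all_reals all_analysis.
From mathcomp Require Import complex.

Set Implicit Arguments.
Unset Strict Implicit.
Unset Printing Implicit Defensive.

Import Order.TTheory GRing.Theory Num.Theory.
Import numFieldNormedType.Exports.

Local Open Scope classical_set_scope.
Local Open Scope ring_scope.
Local Open Scope complex_scope.
Local Open Scope sesquilinear_scope.

Section LinearAlgebra.
Context {R : realType} {N : nat}.

(* Linear in the second argument. *)
Definition cdot (u v : 'cV[R[i]]_N) : R[i] := (u ^t* *m v) 0 0.

(* T(A, B) = N Tr (A B).  The trace is real when A and B are Hermitian, the
   only case in which this is used, so taking Re just changes the type. *)
Definition Tform (A B : 'M[R[i]]_N) : R := N%:R * complex.Re (\tr (A *m B)).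

(* Squared Hilbert-Schmidt norm, Tr (M^* M). *)
Definition hsnorm2 (M : 'M[R[i]]_N) : R :=
  \sum_i \sum_j (complex.Re (M i j) ^+ 2 + complex.Im (M i j) ^+ 2).

End LinearAlgebra.

Section Probability.
Context {d : measure_display} {T : measurableType d} {R : realType}.
Variable P : probability T R.

Definition complex_integrable (X : T -> R[i]) : Prop :=
  P.-integrable setT (fun w => (complex.Re (X w))%:E) /\
  P.-integrable setT (fun w => (complex.Im (X w))%:E).

Definition complex_expectation (X : T -> R[i]) : R[i] :=
  
  fine ('E_P[fun w => complex.Re (X w)])%E +i*
  fine ('E_P[fun w => complex.Im (X w)])%E.

(* Variance 0 is treated separately: in the library normal_prob m 0 is the
   uniform law on [0, 1], not the Dirac mass at m. *)
Definition centered_gaussian (X : T -> R) : Prop :=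
  measurable_fun setT X /\
  ({ae P, forall w, X w = 0} \/
   exists2 s : R, s != 0 &
     forall V : set R, measurable V -> P (X @^-1` V) = normal_prob 0 s V).

Definition filtration (F : R -> set (set T)) : Prop :=
  (forall t : R, 0 <= t -> sigma_algebra setT (F t) /\ F t `<=` measurable) /\
  (forall s t : R, 0 <= s -> s <= t -> F s `<=` F t).

Context {N : nat}.

Definition mx_measurable (G : set (set T)) (X : T -> 'M[R[i]]_N) : Prop :=
  forall i j (V : set R), measurable V ->
    G ((fun w => complex.Re (X w i j)) @^-1` V) /\
    G ((fun w => complex.Im (X w i j)) @^-1` V).

(* The sigma-algebra generated by a random matrix. *)
Definition mx_sigma (X : T -> 'M[R[i]]_N) : set (set T) :=
  <<s [set E | exists i j (V : set R), measurable V /\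
       (E = (fun w => complex.Re (X w i j)) @^-1` V \/
        E = (fun w => complex.Im (X w i j)) @^-1` V)] >>.

Definition continuous_process (X : R -> T -> 'M[R[i]]_N) : Prop :=
  forall w i j,
    {within `[0, +oo[, continuous (fun t : R => complex.Re (X t w i j))} /\
    {within `[0, +oo[, continuous (fun t : R => complex.Im (X t w i j))}.

Definition hermitian_brownian_motion (H : R -> T -> 'M[R[i]]_N) : Prop :=
  [/\ forall (t : R) (w : T), 0 <= t -> H t w \is hermsymmx,
      continuous_process H,
      forall w, H 0 w = 0,
      forall (n : nat) (t : 'I_n -> R) (A : 'I_n -> 'M[R[i]]_N),
        (forall k, 0 <= t k) -> (forall k, A k \is hermsymmx) ->
        centered_gaussian (fun w => \sum_k Tform (A k) (H (t k) w)) &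
      forall (s t : R) (A B : 'M[R[i]]_N),
        0 <= s -> 0 <= t -> A \is hermsymmx -> B \is hermsymmx ->
        ('E_P[fun w => (Tform A (H s w) * Tform B (H t w))%R])%E =
          (Num.min s t * Tform A B)%:E].

(* H is a Brownian motion relative to F: it is F-adapted and its increments
   are independent of the past.  For F the natural filtration of H (possibly
   augmented by null sets) this holds automatically. *)
Definition brownian_relative_to (F : R -> set (set T))
    (H : R -> T -> 'M[R[i]]_N) : Prop :=
  (forall t : R, 0 <= t -> mx_measurable (F t) (H t)) /\
  (forall s t : R, 0 <= s -> s <= t ->
     forall B E, F s B -> mx_sigma (fun w => H t w - H s w) E ->
       P (B `&` E) = (P B * P E)%E).

(* Elementary processes
     phi_s = \sum_(k < n) xi_k 1_[tau_k, tau_(k+1)[ (s). *)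
Record elementary := Elementary {
  el_size : nat ;
  el_time : nat -> R ;
  el_val : nat -> T -> 'M[R[i]]_N }.

Definition elementary_process (F : R -> set (set T)) (t : R)
    (phi : elementary) : Prop :=
  [/\ el_time phi 0%N = 0, el_time phi (el_size phi) = t,
      forall k, (k < el_size phi)%N -> el_time phi k <= el_time phi k.+1 &
      forall k, (k < el_size phi)%N ->
        mx_measurable (F (el_time phi k)) (el_val phi k) /\
        (\int[P]_w (hsnorm2 (el_val phi k w))%:E < +oo)%E].

Definition elementary_at (phi : elementary) (s : R) (w : T) : 'M[R[i]]_N :=
  \sum_(k < el_size phi | el_time phi k <= s < el_time phi k.+1)
     el_val phi k w.

Definition elementary_integral (H : R -> T -> 'M[R[i]]_N) (phi : elementary)
    (w : T) : 'M[R[i]]_N :=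
  \sum_(k < el_size phi)
     (H (el_time phi k.+1) w - H (el_time phi k) w) *m el_val phi k w.

(* Ito integrands on [0, t]: jointly measurable, adapted, square integrable. *)
Definition ito_integrand (F : R -> set (set T)) (t : R)
    (Y : R -> T -> 'M[R[i]]_N) : Prop :=
  [/\ forall i j,
        measurable_fun (`[0, t] `*` setT)
          (fun p : R * T => complex.Re (Y p.1 p.2 i j)) /\
        measurable_fun (`[0, t] `*` setT)
          (fun p : R * T => complex.Im (Y p.1 p.2 i j)),
      forall s : R, 0 <= s -> s <= t -> mx_measurable (F s) (Y s) &
      (\int[P]_w \int[lebesgue_measure]_(s in `[0%R, t])
         (hsnorm2 (Y s w))%:E < +oo)%E].

(* X is (a version of) the Ito integral  \int_0^t (dH_s) Y_s : the L^2(P)-limit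
   of the integrals of elementary processes tending to Y in
   L^2(P \x Lebesgue). *)
Definition is_ito_integral (F : R -> set (set T)) (H : R -> T -> 'M[R[i]]_N)
    (t : R) (Y : R -> T -> 'M[R[i]]_N) (X : T -> 'M[R[i]]_N) : Prop :=
  [/\ ito_integrand F t Y, mx_measurable measurable X &
   exists phi : nat -> elementary,
     [/\ forall n, elementary_process F t (phi n),
         (fun n => \int[P]_w \int[lebesgue_measure]_(s in `[0%R, t])
            (hsnorm2 (Y s w - elementary_at (phi n) s w))%:E)%E
           @ \oo --> 0%E &
         (fun n => \int[P]_w
            (hsnorm2 (X w - elementary_integral H (phi n) w))%:E)%E
           @ \oo --> 0%E]].

Definition time_integral (t : R) (Y : R -> T -> 'M[R[i]]_N) (w : T)
    : 'M[R[i]]_N :=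
  \matrix_(i, j)
    (Rintegral lebesgue_measure `[0, t] (fun s : R => complex.Re (Y s w i j)) +i*
     Rintegral lebesgue_measure `[0, t] (fun s : R => complex.Im (Y s w i j))).

(* The square-integrable adapted solution of
     dU_t = i (dH_t) U_t - (1/2) U_t dt,  U_0 = I,
   in integrated form.  That U_t is unitary is a consequence of the equation
   and is not assumed. *)
Definition unitary_brownian_motion (F : R -> set (set T))
    (H U : R -> T -> 'M[R[i]]_N) : Prop :=
  [/\ continuous_process U,
      forall t : R, 0 <= t -> mx_measurable (F t) (U t),
      forall w, U 0 w = 1%:M &
      forall t : R, 0 <= t -> exists2 X : T -> 'M[R[i]]_N,
        is_ito_integral F H t U X &
        {ae P, forall w,
           U t w = 1%:M + 'i *: X w - 2^-1 *: time_integral t U w}].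

End Probability.

(* Main.v *)
From HB Require Import structures.
Require Import Defs.
From mathcomp Require Import all_boot all_order all_algebra.
From mathcomp Require Import all_classical all_reals all_analysis.
From mathcomp Require Import measurable_realfun complex.
From mathcomp Require Import ring lra.

Set Implicit Arguments.
Unset Strict Implicit.
Unset Printing Implicit Defensive.

Import Order.TTheory GRing.Theory Num.Theory.
Import numFieldNormedType.Exports.

Local Open Scope classical_set_scope.
Local Open Scope ring_scope.
Local Open Scope complex_scope.
Local Open Scope sesquilinear_scope.

(* The second moments q(t) = E<psi_t, A psi_t> are computed from the Ito isometry alone, without
   Ito's formula.  Over a step from s to t = s + h, write
     U_t - U_s = i DX - D/2,   DX = int_s^t (dH) U,   D = int_s^t U dr.
   The martingale part DX is orthogonal to everything F_s-measurable, and since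
   E[dH A dH] = (Tr A / N) dt the isometry gives
     E<DX psi, A DX psi> = (Tr A / N) int_s^t E|psi_r|^2 dr.
   As U is 1/2-Hoelder in L^2, all other terms are controlled, and
     |q(t) - q(s) + h (q(s) - (Tr A / N) p(s))| <= K h^(3/2),   p(s) = E|psi_s|^2.
   For A = I this reads |p(t) - p(s)| <= K h^(3/2), so p is constant, equal to 1; then
   e^t (q(t) - Tr A / N) satisfies a bound of the same form and is constant too. *)

(** * Real bilinear forms on complex matrices *)

(** The exponent 3/2 comes from counting half-powers of h in L^2, where DX has size h^(1/2) and D
    has size h. The pairing of U_s with DX, a priori of order h^(1/2), vanishes by orthogonality.
    Freezing U_r at U_s in the isometry costs h^(1/2) times h, and so does replacing D by h U_s;
    <DX, D> is again h^(3/2), and <D, D> is h^2. Any exponent above 1 would do: over n equal steps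
    these errors add up to a multiple of n^(-1/2). The factor Tr A / N comes from expanding the
    increments of H in a tight frame of Hermitian matrices. The Gram matrix of the frame for T is,
    up to scalars, both the covariance of the coefficients and the matrix that reproduces the frame,
    so the double sum collapses to a Casimir sum. The isometry is proved for the polarised form <X
    psi, A Y psi>. With A = I and psi = e_j, summed over j, it becomes the isometry for the
    Hilbert-Schmidt norm, so one statement serves both the L^2 limits and the drift. *)

Section RealBilinearForms.
Context {R : realType} {N : nat}.
Implicit Types (X Y Z A : 'M[R[i]]_N) (psi u v : 'cV[R[i]]_N).

(** The Boolean is [true] for imaginary parts. One finite index type for all real coordinates turns
    statements on matrices into statements on finite families of real functions. *)
Definition mxcoord (k : 'I_N * 'I_N * bool) X : R :=
  if k.2 then complex.Im (X k.1.1 k.1.2) else complex.Re (X k.1.1 k.1.2).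

Definition mxunit (k : 'I_N * 'I_N * bool) : 'M[R[i]]_N :=
  (if k.2 then 'i else 1) *: delta_mx k.1.1 k.1.2.

Lemma ReD (x y : R[i]) : complex.Re (x + y) = complex.Re x + complex.Re y.
Proof. by case: x y => [? ?] [? ?]. Qed.
Lemma ImD (x y : R[i]) : complex.Im (x + y) = complex.Im x + complex.Im y.
Proof. by case: x y => [? ?] [? ?]. Qed.
Lemma ReZ (r : R) (x : R[i]) : complex.Re (r%:C * x) = r * complex.Re x.
Proof. by case: x => [? ?] /=; rewrite mul0r subr0. Qed.
Lemma ImZ (r : R) (x : R[i]) : complex.Im (r%:C * x) = r * complex.Im x.
Proof. by case: x => [? ?] /=; rewrite mul0r addr0. Qed.

Lemma Re_sum I (r : seq I) (f : I -> R[i]) :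
  complex.Re (\sum_(i <- r) f i) = \sum_(i <- r) complex.Re (f i).
Proof. by apply: (big_morph (@complex.Re R)) => [x y|]; first exact: ReD. Qed.
Lemma Im_sum I (r : seq I) (f : I -> R[i]) :
  complex.Im (\sum_(i <- r) f i) = \sum_(i <- r) complex.Im (f i).
Proof. by apply: (big_morph (@complex.Im R)) => [x y|]; first exact: ImD. Qed.

Lemma mxcoordD k X Y : mxcoord k (X + Y) = mxcoord k X + mxcoord k Y.
Proof. by rewrite /mxcoord mxE; case: k.2; rewrite ?ReD ?ImD. Qed.
Lemma mxcoordZ k (r : R) X : mxcoord k (r%:C *: X) = r * mxcoord k X.
Proof. by rewrite /mxcoord mxE; case: k.2; rewrite ?ReZ ?ImZ. Qed.

Lemma sum_mxindex (V : nmodType) (f : 'I_N * 'I_N * bool -> V) :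
  \sum_k f k = \sum_i \sum_j (f (i, j, false) + f (i, j, true)).
Proof.
rewrite (eq_bigr (fun k => f (k.1, k.2))); last by case.
rewrite -(pair_bigA _ (fun i j => f (i, j))) /=.
rewrite (eq_bigr (fun k => f (k.1, k.2, false) + f (k.1, k.2, true))); last first.
  by move=> [i j] _; rewrite big_bool addrC.
by rewrite -(pair_bigA _ (fun i j => f (i, j, false) + f (i, j, true))).
Qed.

Lemma mx_coord_expand X : X = \sum_k (mxcoord k X)%:C *: mxunit k.
Proof.
rewrite sum_mxindex [LHS]matrix_sum_delta; apply: eq_bigr => i _.
apply: eq_bigr => j _; rewrite /mxcoord /mxunit /= !scalerA -scalerDl.
by congr (_ *: _); rewrite mulr1 [LHS]complexE mulrC.
Qed.

Lemma hsnorm2E X : hsnorm2 X = \sum_k mxcoord k X ^+ 2.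
Proof. by rewrite sum_mxindex. Qed.

Lemma hsnorm2_ge0 X : 0 <= hsnorm2 X.
Proof. by rewrite hsnorm2E sumr_ge0// => k _; rewrite sqr_ge0. Qed.

Lemma mxcoord_sqr_le k X : mxcoord k X ^+ 2 <= hsnorm2 X.
Proof.
rewrite hsnorm2E (bigD1 k) //= lerDl sumr_ge0// => j _; exact: sqr_ge0.
Qed.

(** Homogeneity is asked for real scalars only: this admits [cform], which is conjugate-linear on
    the left, as well as [Tform] and the coordinates of a matrix product. *)
Definition rbilinear (b : 'M[R[i]]_N -> 'M[R[i]]_N -> R) : Prop :=
  [/\ forall X Y Z, b (X + Y) Z = b X Z + b Y Z,
      forall r X Y, b (r%:C *: X) Y = r * b X Y,
      forall X Y Z, b X (Y + Z) = b X Y + b X Z &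
      forall r X Y, b X (r%:C *: Y) = r * b X Y].

Section Theory.
Variable b : 'M[R[i]]_N -> 'M[R[i]]_N -> R.
Hypothesis hb : rbilinear b.

Lemma rbil0l X : b 0 X = 0.
Proof. by case: hb => _ h _ _; rewrite -(scale0r 0) (h 0) mul0r. Qed.
Lemma rbil0r X : b X 0 = 0.
Proof. by case: hb => _ _ _ h; rewrite -(scale0r 0) (h 0) mul0r. Qed.
Lemma rbilNl X Y : b (- X) Y = - b X Y.
Proof. by apply/esym/(addrI (b X Y)); case: hb => hD _ _ _; rewrite -hD !subrr rbil0l. Qed.
Lemma rbilNr X Y : b X (- Y) = - b X Y.
Proof. by apply/esym/(addrI (b X Y)); case: hb => _ _ hD _; rewrite -hD !subrr rbil0r. Qed.
Lemma rbil_suml I (r : seq I) (F : I -> 'M[R[i]]_N) Y :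
  b (\sum_(k <- r) F k) Y = \sum_(k <- r) b (F k) Y.
Proof. by case: hb => hD _ _ _; elim/big_rec2 : _ => [|k x y _ <-]; rewrite ?rbil0l ?hD. Qed.
Lemma rbil_sumr I (r : seq I) (F : I -> 'M[R[i]]_N) Y :
  b Y (\sum_(k <- r) F k) = \sum_(k <- r) b Y (F k).
Proof. by case: hb => _ _ hD _; elim/big_rec2 : _ => [|k x y _ <-]; rewrite ?rbil0r ?hD. Qed.

(** Reduces any such form to finitely many products of real coordinates; its measurability and its
    bounds come from this expansion. *)
Lemma rbil_expand X Y :
  b X Y = \sum_k \sum_l b (mxunit k) (mxunit l) * (mxcoord k X * mxcoord l Y).
Proof.
rewrite {1}(mx_coord_expand X) rbil_suml; apply: eq_bigr => k _.
rewrite {1}(mx_coord_expand Y) rbil_sumr; apply: eq_bigr => l _.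
by case: hb => _ hl _ hr; rewrite hl hr; ring.
Qed.
End Theory.

(** The real part loses nothing on the diagonal when [A] is Hermitian ([cdot_Im]). The two matrix
    arguments are kept apart because the step estimate contains mixed terms. *)
Definition cform psi A X Y : R :=
  complex.Re (cdot (X *m psi) (A *m (Y *m psi))).

Lemma conj_realC (r : R) : Num.conj (r%:C) = r%:C.
Proof. exact: conjc_real. Qed.

Lemma cdotDl u v w : cdot (u + v) w = cdot u w + cdot v w :> R[i].
Proof. by rewrite /cdot linearD/= map_mxD mulmxDl mxE. Qed.
Lemma cdotDr u v w : cdot w (u + v) = cdot w u + cdot w v :> R[i].
Proof. by rewrite /cdot mulmxDr mxE. Qed.
Lemma cdotZl (a : R[i]) u v : cdot (a *: u) v = a^* * cdot u v.
Proof. by rewrite /cdot linearZ/= map_mxZ -scalemxAl mxE. Qed.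
Lemma cdotZr (a : R[i]) u v : cdot u (a *: v) = a * cdot u v.
Proof. by rewrite /cdot -scalemxAr mxE. Qed.
Lemma cdotE u v : cdot u v = \sum_i (u i 0)^* * v i 0.
Proof. by rewrite /cdot mxE; apply: eq_bigr => i _; rewrite !mxE. Qed.
Lemma cdotC u v : cdot v u = Num.conj (cdot u v).
Proof.
rewrite !cdotE rmorph_sum /=; apply: eq_bigr => i _.
by rewrite rmorphM /= conjCK mulrC.
Qed.
Lemma cdot_mulmx A u v : cdot (A *m u) v = cdot u ((A ^t*) *m v).
Proof. by rewrite /cdot trmx_mul map_mxM mulmxA. Qed.

Lemma herm_adj A : A \is hermsymmx -> A ^t* = A.
Proof. by move/is_hermitianmxP => {2}->; rewrite expr0 scale1r. Qed.
Lemma adj_herm A : A ^t* = A -> A \is hermsymmx.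
Proof. by move=> h; apply/is_hermitianmxP; rewrite expr0 scale1r h. Qed.

Lemma cform_rbilinear psi A : rbilinear (cform psi A).
Proof.
split=> [X Y Z|r X Y|X Y Z|r X Y]; rewrite /cform; cbv beta.
- by rewrite mulmxDl cdotDl ReD.
- by rewrite -scalemxAl cdotZl conj_realC ReZ.
- by rewrite mulmxDl mulmxDr cdotDr ReD.
- by rewrite -scalemxAl -scalemxAr cdotZr ReZ.
Qed.

Lemma cform_sym psi A X Y : A \is hermsymmx -> cform psi A X Y = cform psi A Y X.
Proof.
move=> /herm_adj hA; rewrite /cform cdotC cdot_mulmx hA.
by case: (cdot _ _).
Qed.

(** Since conj(i) i = 1, the factor i of the equation disappears from the quadratic term of the
    martingale part. *)
Lemma cformiZ psi A X Y : cform psi A ('i *: X) ('i *: Y) = cform psi A X Y.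
Proof.
rewrite /cform -!scalemxAl -scalemxAr cdotZl cdotZr mulrA.
have -> : ('i%C : R[i])^* * 'i%C = 1.
  by apply/eqP;
    rewrite eq_complex /=; apply/andP; split; apply/eqP; ring.
by rewrite mul1r.
Qed.

(** The j-th summand is the squared length of the j-th column. Through this sum the isometry for
    [cform] becomes one for the Hilbert-Schmidt norm. *)
Lemma hsnorm2_cform X : hsnorm2 X = \sum_j cform (delta_mx j 0) 1%:M X X.
Proof.
rewrite /hsnorm2 exchange_big /=; apply: eq_bigr => j _.
rewrite /cform mul1mx cdotE.
rewrite Re_sum.
apply: eq_bigr => i _; rewrite -colE mxE.
by case: (X i j) => a c /=; rewrite mulNr opprK !expr2.
Qed.

Lemma cdot_Im psi A X : A \is hermsymmx ->
  complex.Im (cdot (X *m psi) (A *m (X *m psi))) = 0.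
Proof.
move=> /herm_adj hA; have := cdotC (A *m (X *m psi)) (X *m psi).
rewrite (cdot_mulmx A) hA; case: (cdot _ _) => a c /=.
by case=> /eqP; rewrite -addr_eq0 -mulr2n mulrn_eq0 /= => /eqP.
Qed.

End RealBilinearForms.

(** * Hermitian matrices: a tight frame and its Casimir identity *)

Section HermitianFrame.
Context {R : realType} {N : nat}.
Implicit Types (X Y Z A H : 'M[R[i]]_N) (psi u v : 'cV[R[i]]_N).

(* Indexed by all pairs (i, j) and not only i <= j, so that every entry is counted twice: a tight
   frame and not a basis, hence the weight 1 / (4 N) below. *)
Definition herm_frame (k : 'I_N * 'I_N * bool) : 'M[R[i]]_N :=
  if k.2 then 'i *: (delta_mx k.1.1 k.1.2 - delta_mx k.1.2 k.1.1)
  else delta_mx k.1.1 k.1.2 + delta_mx k.1.2 k.1.1.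

Lemma conj_i : Num.conj ('i%C : R[i]) = - 'i%C.
Proof. by apply/eqP; rewrite eq_complex /= oppr0 !eqxx. Qed.

Lemma mulii : ('i%C : R[i]) * 'i%C = -1.
Proof. by rewrite -expr2 sqr_i. Qed.

Lemma delta_mx_adj (i j : 'I_N) : (delta_mx i j : 'M[R[i]]_N) ^t* = delta_mx j i.
Proof. by rewrite trmx_delta map_delta_mx. Qed.

Lemma herm_frameP k : herm_frame k \is hermsymmx.
Proof.
apply: adj_herm; rewrite /herm_frame; case: k => [[i j] [|]] /=.
  rewrite linearZ /= linearB /= map_mxZ map_mxB !delta_mx_adj /= conj_i.
  by rewrite scaleNr -scalerN opprB.
by rewrite linearD /= map_mxD !delta_mx_adj addrC.
Qed.

Lemma mxtrace_delta_mul (i j : 'I_N) X : \tr (delta_mx i j *m X) = X j i.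
Proof.
rewrite /mxtrace (bigD1 i) //= big1 ?addr0; last first.
  move=> k ki; rewrite mxE big1// => l _; rewrite mxE (negbTE ki) /=.
  by rewrite mul0r.
rewrite mxE (bigD1 j) //= big1 ?addr0; last first.
  by move=> k kj; rewrite mxE (negbTE kj) andbF mul0r.
by rewrite mxE !eqxx mul1r.
Qed.

Lemma herm_entryC H i j : H \is hermsymmx -> H j i = Num.conj (H i j).
Proof. by move=> /herm_adj hH; rewrite -[in LHS]hH !mxE. Qed.

(** The entries at (i, j) and (j, i) are conjugate, so the frame element picks up twice a real or an
    imaginary part; the factor N is the one in [Tform]. *)
Lemma Tform_herm_frame k H : H \is hermsymmx ->
  Tform (herm_frame k) H = 2 * N%:R * mxcoord k H.
Proof.
case: k => [[i j] b] hH; rewrite /Tform /herm_frame /mxcoord /=.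
case: b => /=.
  rewrite -scalemxAl linearZ /= mulmxBl linearB /= !mxtrace_delta_mul.
  rewrite (herm_entryC i j hH); case: (H i j) => x y /=; ring.
rewrite mulmxDl linearD /= !mxtrace_delta_mul (herm_entryC i j hH).
case: (H i j) => x y /=; ring.
Qed.

Lemma herm_frame_expand H : (0 < N)%N -> H \is hermsymmx ->
  H = \sum_k ((4 * N%:R)^-1 * Tform (herm_frame k) H)%:C *: herm_frame k.
Proof.
move=> N0 hH; have N1 : N%:R != 0 :> R by rewrite pnatr_eq0 -lt0n.
have E (k : 'I_N * 'I_N * bool) :
    (4 * N%:R)^-1 * Tform (herm_frame k) H = 2^-1 * mxcoord k H.
  by rewrite Tform_herm_frame//; field.
under eq_bigr do rewrite E.
rewrite sum_mxindex /mxcoord /herm_frame /=.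
(* Regroup by matrix units: Re/2 + i Im/2 = H_ij/2 multiplies [delta_mx i j], and its conjugate
   H_ji/2 multiplies [delta_mx j i]. Exchanging the indices in the second sum then yields each entry
   as two halves. *)
have -> : \sum_(i < N) \sum_(j < N)
    ((2^-1 * complex.Re (H i j))%:C *: (delta_mx i j + delta_mx j i) +
     (2^-1 * complex.Im (H i j))%:C *: ('i *: (delta_mx i j - delta_mx j i))) =
  \sum_(i < N) \sum_(j < N) (2^-1%:C * H i j) *: delta_mx i j +
  \sum_(i < N) \sum_(j < N) (2^-1%:C * H j i) *: delta_mx j i :> 'M[R[i]]_N.
  rewrite -big_split; apply: eq_bigr => i _; rewrite -big_split.
  apply: eq_bigr => j _ /=; rewrite (herm_entryC i j hH) scalerA scalerDr scalerBr.
  rewrite addrACA -scalerDl -scalerBl; congr (_ *: _ + _ *: _).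
    by case: (H i j) => x y; apply/eqP; rewrite eq_complex /=; apply/andP; split; apply/eqP; ring.
  by case: (H i j) => x y; apply/eqP; rewrite eq_complex /=; apply/andP; split; apply/eqP; ring.
rewrite [X in _ + X]exchange_big /= -big_split /= [LHS]matrix_sum_delta.
apply: eq_bigr => i _; rewrite -big_split /=; apply: eq_bigr => j _.
rewrite -scalerDl -mulrDl; congr (_ *: _).
rewrite -[LHS]mul1r; congr (_ * _).
by apply/eqP; rewrite eq_complex /=; apply/andP; split; apply/eqP; field.
Qed.

Lemma delta_mul_mul (i j k l : 'I_N) A :
  delta_mx i j *m A *m delta_mx k l = A j k *: delta_mx i l.
Proof.
apply/matrixP => a b; rewrite !mxE (bigD1 k) //= big1 ?addr0; last first.
  by move=> c ck; rewrite [X in _ * X]mxE (negbTE ck) mulr0.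
rewrite !mxE eqxx /= (bigD1 j) //= big1 ?addr0; last first.
  by move=> c cj; rewrite [X in X * _]mxE (negbTE cj) andbF mul0r.
by rewrite mxE eqxx andbT; case: (a == i); case: (b == l) => /=; ring.
Qed.

(** With E_ij A E_kl = A_jk E_il, the symmetric element contributes A_ji E_ij + A_ij E_ji + A_jj
    E_ii + A_ii E_jj, and the antisymmetric one, because of i^2 = -1, the same with the first two
    terms negated. Only the diagonal terms survive, doubled, and each of the two sums to 2 Tr A
    times I. *)
Lemma herm_frame_casimir A :
  \sum_k herm_frame k *m A *m herm_frame k = (4 * \tr A)%:M.
Proof.
rewrite sum_mxindex /herm_frame /=.
transitivity (\sum_(i < N) \sum_(j < N) ((2 * A j j) *: delta_mx i i +
    (2 * A i i) *: delta_mx j j : 'M[R[i]]_N)).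
  apply: eq_bigr => i _; apply: eq_bigr => j _.
  rewrite -!scalemxAl -!scalemxAr scalerA mulii scaleN1r.
  rewrite !(mulmxDl, mulmxDr, mulNmx, mulmxN) !delta_mul_mul.
  rewrite !mulr2n !mulrDl !mul1r !scalerDl.
  apply/matrixP => a b; rewrite !mxE. ring.
under eq_bigr do rewrite big_split.
rewrite big_split /= [X in _ + X]exchange_big /= -big_split /=.
have -> : (4 * \tr A)%:M = \sum_i (4 * \tr A) *: (delta_mx i i : 'M[R[i]]_N).
  rewrite -scaler_sumr -scalemx1; congr (_ *: _).
  by rewrite [LHS]matrix_sum_delta; apply: eq_bigr => i _; rewrite (bigD1 i) //= big1 ?addr0
    ?mxE ?eqxx ?scale1r// => j ji; rewrite mxE eq_sym (negbTE ji) scale0r.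
apply: eq_bigr => i _; rewrite -scaler_suml -mulr_sumr -mulr2n -scaler_nat.
by rewrite scalerA mulrA -natrM.
Qed.

Lemma Tform_sym A H : Tform A H = Tform H A :> R.
Proof. by rewrite /Tform mxtrace_mulC. Qed.

Lemma herm_trace_Im A : A \is hermsymmx -> complex.Im (\tr A) = 0.
Proof.
move=> hA; rewrite /mxtrace Im_sum big1// => i _; have := herm_entryC i i hA.
case: (A i i) => x y /= [] /eqP; rewrite -addr_eq0 -mulr2n mulrn_eq0 /=.
by move/eqP.
Qed.

(** The algebra behind E[dH A dH] = (Tr A / N) dt. The sum over l is the frame expansion of
    [herm_frame k] itself; what remains is the Casimir sum with weight 1 / (4 N), and its value 4 Tr
    A gives Tr A / N. *)
Lemma cform_casimir psi A X Y : (0 < N)%N -> A \is hermsymmx ->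
  \sum_k \sum_l ((4 * N%:R)^-1 ^+ 2 * Tform (herm_frame k) (herm_frame l) *
     cform psi A (herm_frame k *m X) (herm_frame l *m Y)) =
  complex.Re (\tr A) / N%:R * cform psi 1%:M X Y.
Proof.
move=> N0 hA; have N1 : N%:R != 0 :> R by rewrite pnatr_eq0 -lt0n.
have [_ _ _ bZ] := cform_rbilinear psi A.
transitivity (\sum_k ((4 * N%:R)^-1 * cform psi A (herm_frame k *m X) (herm_frame k *m Y))).
  apply: eq_bigr => k _.
  rewrite [in Z0 in _ = _ * cform _ _ _ Z0](herm_frame_expand N0 (herm_frameP k)) mulmx_suml.
  rewrite (rbil_sumr (cform_rbilinear psi A)) mulr_sumr; apply: eq_bigr => l _.
  rewrite -scalemxAl bZ Tform_sym; ring.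
rewrite -mulr_sumr /cform -Re_sum.
under eq_bigr => k _ do
  rewrite -[herm_frame k *m X *m psi]mulmxA cdot_mulmx (herm_adj (herm_frameP k)).
have -> : \sum_k cdot (X *m psi) (herm_frame k *m (A *m (herm_frame k *m Y *m psi))) =
   cdot (X *m psi) ((\sum_k herm_frame k *m A *m herm_frame k) *m (Y *m psi)).
  rewrite /cdot !mulmx_suml mulmx_sumr summxE; apply: eq_bigr => k _.
  by rewrite !mulmxA.
rewrite herm_frame_casimir mul_scalar_mx mul1mx cdotZr.
have : complex.Im (\tr A) = 0 by exact: herm_trace_Im.
case: (\tr A) (cdot _ _) => x y [z t] /= ->; rewrite ?addr0.
by field; rewrite N1.
Qed.

End HermitianFrame.

(** * Square-integrable random matrices *)

Section FiniteSums.
Context {d : measure_display} {T : measurableType d} {R : realType}.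
Variable m : {measure set T -> \bar R}.

Lemma integrableZlR (r : R) (f : T -> R) : m.-integrable setT (EFin \o f) ->
  m.-integrable setT (EFin \o (fun w => r * f w)).
Proof. exact: integrableZl. Qed.

Lemma integrableDR (f g : T -> R) : m.-integrable setT (EFin \o f) ->
  m.-integrable setT (EFin \o g) ->
  m.-integrable setT (EFin \o (fun w => f w + g w)).
Proof. by move=> fi gi; exact: (integrableD measurableT fi gi). Qed.

Lemma integrable_sumR I (r : seq I) (f : I -> T -> R) :
  (forall k, m.-integrable setT (EFin \o f k)) ->
  m.-integrable setT (EFin \o (fun w => \sum_(k <- r) f k w)).
Proof.
move=> fi; elim: r => [|k r IH].
  by apply: (eq_integrable _ (cst 0%E)) => //; [move=> w _ /=; rewrite big_nil|exact: integrable0].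
apply: (eq_integrable _ (EFin \o (fun w => f k w + \sum_(j <- r) f j w))) => //.
  by move=> w _ /=; rewrite big_cons.
exact: integrableDR.
Qed.

Lemma Rintegral_sum I (r : seq I) (f : I -> T -> R) :
  (forall k, m.-integrable setT (EFin \o f k)) ->
  \int[m]_w (\sum_(k <- r) f k w) = \sum_(k <- r) \int[m]_w f k w.
Proof.
move=> fi; elim: r => [|k r IH].
  by rewrite big_nil; under eq_Rintegral do rewrite big_nil; rewrite /Rintegral integral0.
under eq_Rintegral do rewrite big_cons.
by rewrite RintegralD ?big_cons ?IH//; exact: integrable_sumR.
Qed.

End FiniteSums.

Section SquareIntegrable.
Context {R : realType} {N : nat}.
Local Notation M := 'M[R[i]]_N.
Local Notation index := ('I_N * 'I_N * bool)%type.

(** A crude substitute for the operator norm; it only has to be a constant depending on [b]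
    alone. *)
Definition form_bound (b : M -> M -> R) : R :=
  \sum_k \sum_l `|b (mxunit k) (mxunit l)|.

Lemma form_bound_ge0 b : 0 <= form_bound b.
Proof. by apply: sumr_ge0 => k _; apply: sumr_ge0. Qed.

(** Coordinatewise 2|xy| <= lam x^2 + y^2 / lam, the two signs of xy coming from the squares [e0]
    and [e1]. The parameter stays free so that it can be optimised after integration. *)
Lemma rbil_AMGM b (lam : R) (X Y : M) : rbilinear b -> 0 < lam ->
  `|b X Y| <= form_bound b * (lam * hsnorm2 X + lam^-1 * hsnorm2 Y).
Proof.
move=> hb l0; rewrite (rbil_expand hb) (le_trans (ler_norm_sum _ _ _))//.
rewrite mulr_suml; apply: ler_sum => k _.
rewrite (le_trans (ler_norm_sum _ _ _))// mulr_suml; apply: ler_sum => l _.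
rewrite normrM ler_wpM2l//.
have hX := mxcoord_sqr_le k X; have hY := mxcoord_sqr_le l Y.
apply: (@le_trans _ _ (lam * mxcoord k X ^+ 2 + lam^-1 * mxcoord l Y ^+ 2)); last first.
  by rewrite lerD// ler_wpM2l// ?invr_ge0 ltW.
set x := mxcoord k X; set y := mxcoord l Y.
have e0 : 0 <= lam * (x - lam^-1 * y) ^+ 2 by rewrite mulr_ge0 ?sqr_ge0// ltW.
have e1 : 0 <= lam * (x + lam^-1 * y) ^+ 2 by rewrite mulr_ge0 ?sqr_ge0// ltW.
have E0 : lam * (x - lam^-1 * y) ^+ 2 = lam * x ^+ 2 + lam^-1 * y ^+ 2 - 2 * (x * y).
  by field; rewrite gt_eqF.
have E1 : lam * (x + lam^-1 * y) ^+ 2 = lam * x ^+ 2 + lam^-1 * y ^+ 2 + 2 * (x * y).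
  by field; rewrite gt_eqF.
have p0 : 0 <= lam * x ^+ 2 + lam^-1 * y ^+ 2.
  by rewrite addr_ge0// mulr_ge0 ?sqr_ge0 ?invr_ge0 ?ltW.
by rewrite ler_norml; apply/andP; split; lra.
Qed.

Lemma rbil_mxcoord_mul (k : index) : rbilinear (fun X Y : M => mxcoord k (X *m Y)).
Proof.
split=> [X Y Z|r X Y|X Y Z|r X Y].
- by rewrite mulmxDl mxcoordD.
- by rewrite -scalemxAl mxcoordZ.
- by rewrite mulmxDr mxcoordD.
- by rewrite -scalemxAr mxcoordZ.
Qed.

Lemma hsnorm2Z (r : R) (X : M) : hsnorm2 (r%:C *: X) = r ^+ 2 * hsnorm2 X.
Proof.
rewrite !hsnorm2E mulr_sumr; apply: eq_bigr => k _.
by rewrite mxcoordZ exprMn.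
Qed.

Lemma hsnorm2N (X : M) : hsnorm2 (- X) = hsnorm2 X.
Proof.
rewrite -scaleN1r (_ : -1 = (-1)%:C); first by rewrite hsnorm2Z sqrrN expr1n mul1r.
by apply/eqP; rewrite eq_complex /= oppr0 !eqxx.
Qed.

Lemma hsnorm20 : hsnorm2 (0 : M) = 0.
Proof. by rewrite -(scale0r 0) (hsnorm2Z 0) expr0n mul0r. Qed.

Lemma hsnorm2_iZ (X : M) : hsnorm2 ('i *: X) = hsnorm2 X.
Proof. by rewrite !hsnorm2_cform; apply: eq_bigr => j _; rewrite cformiZ. Qed.

Lemma hsnorm2D_le (X Y : M) : hsnorm2 (X + Y) <= 2 * hsnorm2 X + 2 * hsnorm2 Y.
Proof.
rewrite !hsnorm2E !mulr_sumr -big_split; apply: ler_sum => k _ /=.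
rewrite mxcoordD; have := sqr_ge0 (mxcoord k X - mxcoord k Y).
by rewrite !expr2; lra.
Qed.

(** The Hilbert-Schmidt product pulled back by X -> A X is real bilinear, so [rbil_AMGM] applies
    with equal arguments and parameter 1; hence the factor 2. *)
Lemma hsnorm2_constMl_le (A : M) : exists2 K : R, 0 <= K &
  forall X, hsnorm2 (A *m X) <= K * hsnorm2 X.
Proof.
pose b X Y : R := \sum_k mxcoord k (A *m X) * mxcoord k (A *m Y).
have hb : rbilinear b.
  split=> [X Y Z|r X Y|X Y Z|r X Y]; rewrite /b.
  - by rewrite -big_split; apply: eq_bigr => k _; rewrite mulmxDr mxcoordD mulrDl.
  - by rewrite mulr_sumr; apply: eq_bigr => k _; rewrite -scalemxAr mxcoordZ mulrA.
  - by rewrite -big_split; apply: eq_bigr => k _; rewrite mulmxDr mxcoordD mulrDr.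
  - by rewrite mulr_sumr; apply: eq_bigr => k _; rewrite -scalemxAr mxcoordZ mulrCA.
exists (form_bound b * 2); first by rewrite mulr_ge0 ?form_bound_ge0.
move=> X; have := rbil_AMGM X X hb ltr01; rewrite invr1 !mul1r.
rewrite -mulr2n -(mulr_natl (hsnorm2 X)) mulrA; apply: le_trans.
rewrite (le_trans _ (ler_norm _))// hsnorm2E /b le_eqVlt; apply/orP; left.
by apply/eqP; apply: eq_bigr.
Qed.

Section MeasurableMatrices.
Context {d : measure_display} {S : measurableType d}.
Implicit Types X Y Z : S -> M.

Definition mxmeas X : Prop := forall k, measurable_fun setT (fun w => mxcoord k (X w)).

Lemma mxmeas_rbil b X Y : rbilinear b -> mxmeas X -> mxmeas Y ->
  measurable_fun setT (fun w => b (X w) (Y w)).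
Proof.
move=> hb mX mY; under eq_fun do rewrite (rbil_expand hb).
apply: measurable_sum => k; apply: measurable_sum => l.
apply: measurable_funM => //; exact: measurable_funM.
Qed.

Lemma mxmeas_hsnorm2 X : mxmeas X -> measurable_fun setT (fun w => hsnorm2 (X w)).
Proof.
move=> mX; under eq_fun do rewrite hsnorm2E.
by apply: measurable_sum => k; apply: measurable_funX.
Qed.

Lemma mxmeas_cst A : mxmeas (fun=> A).
Proof. by move=> k; exact: measurable_cst. Qed.

Lemma mxmeasD X Y : mxmeas X -> mxmeas Y -> mxmeas (fun w => X w + Y w).
Proof.
move=> mX mY k; under eq_fun do rewrite mxcoordD; exact: measurable_funD.
Qed.

Lemma mxmeasM X Y : mxmeas X -> mxmeas Y -> mxmeas (fun w => X w *m Y w).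
Proof. move=> mX mY k; exact: (mxmeas_rbil (rbil_mxcoord_mul k)). Qed.

Lemma mxmeas_scale (c : R[i]) X : mxmeas X -> mxmeas (fun w => c *: X w).
Proof.
move=> mX; under eq_fun do rewrite -mul_scalar_mx.
by apply: mxmeasM => //; exact: mxmeas_cst.
Qed.

Lemma mxmeas_scaler (f : S -> R) X : measurable_fun setT f -> mxmeas X ->
  mxmeas (fun w => (f w)%:C *: X w).
Proof.
move=> mf mX k; under eq_fun do rewrite mxcoordZ; exact: measurable_funM.
Qed.

Lemma mxmeasN X : mxmeas X -> mxmeas (fun w => - X w).
Proof. by move=> mX; under eq_fun do rewrite -scaleN1r; exact: mxmeas_scale. Qed.

Lemma mxmeasB X Y : mxmeas X -> mxmeas Y -> mxmeas (fun w => X w - Y w).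
Proof. by move=> mX mY; apply: mxmeasD => //; exact: mxmeasN. Qed.

End MeasurableMatrices.

Section L2.
Context {d : measure_display} {S : measurableType d}.
Variable m : {measure set S -> \bar R}.
Implicit Types X Y Z : S -> M.

(** The measure is a parameter because the same theory is used over [P] and over Lebesgue measure
    times [P], the two sides of the isometry. *)
Definition mxL2 X : Prop :=
  mxmeas X /\ (\int[m]_w (hsnorm2 (X w))%:E < +oo)%E.

Definition form_int (b : M -> M -> R) X Y : R := \int[m]_w b (X w) (Y w).
(** [Rintegral] sends an infinite integral to 0, so this value is meaningful only together with
    [mxL2]; [mxL2_norm2] is the link to the extended integral. *)
Definition norm2_int X : R := \int[m]_w hsnorm2 (X w).

Lemma mxL2_int X : mxL2 X -> m.-integrable setT (fun w => (hsnorm2 (X w))%:E).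
Proof.
case=> mX iX; apply/integrableP; split.
  by apply/measurable_EFinP; exact: mxmeas_hsnorm2.
by under eq_integral do rewrite gee0_abs ?lee_fin ?hsnorm2_ge0//.
Qed.

Lemma mxL2_norm2 X : mxL2 X -> (\int[m]_w (hsnorm2 (X w))%:E = (norm2_int X)%:E)%E.
Proof.
by move=> hX; rewrite fineK//; apply: integrable_fin_num => //; exact: mxL2_int.
Qed.

Lemma norm2_int_ge0 X : 0 <= norm2_int X.
Proof. by apply: Rintegral_ge0 => w _; exact: hsnorm2_ge0. Qed.

Lemma mxL2_le X (f : S -> R) : mxmeas X -> m.-integrable setT (EFin \o f) ->
  (forall w, hsnorm2 (X w) <= f w) -> mxL2 X.
Proof.
move=> mX fi le; split=> //.
have /integrableP[_] : m.-integrable setT (fun w => (hsnorm2 (X w))%:E).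
  apply: le_integrable fi => //.
    by apply/measurable_EFinP; exact: mxmeas_hsnorm2.
  move=> w _ /=; rewrite lee_fin ger0_norm ?hsnorm2_ge0//.
  exact: le_trans (le w) (ler_norm _).
by under eq_integral do rewrite gee0_abs ?lee_fin ?hsnorm2_ge0//.
Qed.

Lemma mxL2D X Y : mxL2 X -> mxL2 Y -> mxL2 (fun w => X w + Y w).
Proof.
move=> hX hY; apply: (@mxL2_le _ (fun w => 2 * hsnorm2 (X w) + 2 * hsnorm2 (Y w))).
- by apply: mxmeasD; [case: hX|case: hY].
- by apply: integrableDR; apply: integrableZlR; exact: mxL2_int.
- by move=> w; exact: hsnorm2D_le.
Qed.

Lemma mxL2N X : mxL2 X -> mxL2 (fun w => - X w).
Proof.
case=> mX iX; split; first exact: mxmeasN.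
by under eq_integral do rewrite hsnorm2N.
Qed.

Lemma mxL2B X Y : mxL2 X -> mxL2 Y -> mxL2 (fun w => X w - Y w).
Proof. by move=> hX hY; apply: mxL2D => //; exact: mxL2N. Qed.

Lemma mxL2_iZ X : mxL2 X -> mxL2 (fun w => 'i *: X w).
Proof.
case=> mX iX; split; first exact: mxmeas_scale.
by under eq_integral do rewrite hsnorm2_iZ.
Qed.

Lemma mxL2Z (r : R) X : mxL2 X -> mxL2 (fun w => r%:C *: X w).
Proof.
move=> hX; apply: (@mxL2_le _ (fun w => r ^+ 2 * hsnorm2 (X w))).
- by apply: mxmeas_scale; case: hX.
- by apply: integrableZlR; exact: mxL2_int.
- by move=> w; rewrite hsnorm2Z.
Qed.

Lemma mxL2_constMl A X : mxL2 X -> mxL2 (fun w => A *m X w).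
Proof.
move=> hX; have [K K0 hK] := hsnorm2_constMl_le A.
apply: (@mxL2_le _ (fun w => K * hsnorm2 (X w))) => //.
- by apply: mxmeasM; [exact: mxmeas_cst|case: hX].
- by apply: integrableZlR; exact: mxL2_int.
Qed.

Lemma mxL20 : mxL2 (fun=> 0).
Proof.
split; first exact: mxmeas_cst.
by under eq_integral do rewrite hsnorm20; rewrite integral0.
Qed.

Lemma mxL2_sum I (r : seq I) (F : I -> S -> M) :
  (forall k, mxL2 (F k)) -> mxL2 (fun w => \sum_(k <- r) F k w).
Proof.
move=> hF; elim: r => [|k r IH].
  by under eq_fun do rewrite big_nil; exact: mxL20.
by under eq_fun do rewrite big_cons; exact: mxL2D.
Qed.

Lemma mxL2_form b X Y : rbilinear b -> mxL2 X -> mxL2 Y ->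
  m.-integrable setT (EFin \o (fun w => b (X w) (Y w))).
Proof.
move=> hb hX hY.
apply: (@le_integrable _ _ _ _ _ measurableT _
  (EFin \o (fun w => form_bound b * (1 * hsnorm2 (X w) + 1^-1 * hsnorm2 (Y w))))).
- by apply/measurable_EFinP; apply: mxmeas_rbil => //; [case: hX|case: hY].
- move=> w _ /=; rewrite lee_fin (le_trans (rbil_AMGM _ _ hb ltr01))//.
  exact: ler_norm.
- apply: integrableZlR; apply: integrableDR; apply: integrableZlR; exact: mxL2_int.
Qed.

Section Form.
Variable b : M -> M -> R.
Hypothesis hb : rbilinear b.

Lemma form_intDl X Y Z : mxL2 X -> mxL2 Y -> mxL2 Z ->
  form_int b (fun w => X w + Y w) Z = form_int b X Z + form_int b Y Z.
Proof.
move=> hX hY hZ; rewrite /form_int -RintegralD//; try exact: mxL2_form.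
by apply: eq_Rintegral => w _; case: hb => ->.
Qed.

Lemma form_intDr X Y Z : mxL2 X -> mxL2 Y -> mxL2 Z ->
  form_int b X (fun w => Y w + Z w) = form_int b X Y + form_int b X Z.
Proof.
move=> hX hY hZ; rewrite /form_int -RintegralD//; try exact: mxL2_form.
by apply: eq_Rintegral => w _; case: hb => _ _ ->.
Qed.

Lemma form_intNl X Y : mxL2 X -> mxL2 Y ->
  form_int b (fun w => - X w) Y = - form_int b X Y.
Proof.
move=> hX hY; rewrite /form_int -mulN1r -RintegralZl//; last exact: mxL2_form.
by apply: eq_Rintegral => w _; rewrite rbilNl// mulN1r.
Qed.

Lemma form_intNr X Y : mxL2 X -> mxL2 Y ->
  form_int b X (fun w => - Y w) = - form_int b X Y.
Proof.
move=> hX hY; rewrite /form_int -mulN1r -RintegralZl//; last exact: mxL2_form.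
by apply: eq_Rintegral => w _; rewrite rbilNr// mulN1r.
Qed.

Lemma form_intBl X Y Z : mxL2 X -> mxL2 Y -> mxL2 Z ->
  form_int b (fun w => X w - Y w) Z = form_int b X Z - form_int b Y Z.
Proof. by move=> *; rewrite form_intDl ?form_intNl//; exact: mxL2N. Qed.

Lemma form_intBr X Y Z : mxL2 X -> mxL2 Y -> mxL2 Z ->
  form_int b X (fun w => Y w - Z w) = form_int b X Y - form_int b X Z.
Proof. by move=> *; rewrite form_intDr ?form_intNr//; exact: mxL2N. Qed.

Lemma form_intZl r X Y : mxL2 X -> mxL2 Y ->
  form_int b (fun w => r%:C *: X w) Y = r * form_int b X Y.
Proof.
move=> hX hY; rewrite /form_int -RintegralZl//; last exact: mxL2_form.
by apply: eq_Rintegral => w _; case: hb => _ ->.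
Qed.

Lemma form_intZr r X Y : mxL2 X -> mxL2 Y ->
  form_int b X (fun w => r%:C *: Y w) = r * form_int b X Y.
Proof.
move=> hX hY; rewrite /form_int -RintegralZl//; last exact: mxL2_form.
by apply: eq_Rintegral => w _; case: hb => _ _ _ ->.
Qed.

Lemma form_int0l Y : form_int b (fun=> 0) Y = 0.
Proof.
rewrite /form_int (@eq_Rintegral _ _ _ _ _ (cst 0)) => [|w _]; last by rewrite rbil0l.
by rewrite /Rintegral integral0.
Qed.

Lemma form_int0r X : form_int b X (fun=> 0) = 0.
Proof.
rewrite /form_int (@eq_Rintegral _ _ _ _ _ (cst 0)) => [|w _]; last by rewrite rbil0r.
by rewrite /Rintegral integral0.
Qed.

Lemma le_sqrt_AMGM (x a c : R) : 0 <= a -> 0 <= c ->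
  (forall l, 0 < l -> x <= l * a + l^-1 * c) -> x <= 2 * (Num.sqrt a * Num.sqrt c).
Proof.
move=> a0 c0 h.
have [az|anz] := eqVneq a 0.
  rewrite az sqrtr0 mul0r mulr0; apply/ler_addgt0Pr => e e0; rewrite add0r.
  have c1 : 0 < c + 1 by lra.
  apply: (le_trans (h ((c + 1) / e) _)); first by rewrite divr_gt0.
  rewrite az mulr0 add0r invf_div mulrAC ler_pdivrMr// ler_wpM2l ?ltW//; lra.
have [cz|cnz] := eqVneq c 0.
  rewrite cz sqrtr0 mulr0 mulr0; apply/ler_addgt0Pr => e e0; rewrite add0r.
  have a1 : 0 < a + 1 by lra.
  apply: (le_trans (h (e / (a + 1)) _)); first by rewrite divr_gt0.
  rewrite cz mulr0 addr0 mulrAC ler_pdivrMr// ler_wpM2l ?ltW//; lra.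
have pa : 0 < a by rewrite lt_neqAle eq_sym anz.
have pc : 0 < c by rewrite lt_neqAle eq_sym cnz.
set p := Num.sqrt a; set q := Num.sqrt c.
have p0 : 0 < p by rewrite sqrtr_gt0.
have q0 : 0 < q by rewrite sqrtr_gt0.
apply: (le_trans (h (q / p) _)); first by rewrite divr_gt0.
rewrite -(sqr_sqrtr a0) -(sqr_sqrtr c0) -/p -/q le_eqVlt; apply/orP; left.
by apply/eqP; field; rewrite !gt_eqF.
Qed.

(** Cauchy-Schwarz, obtained by integrating [rbil_AMGM] and choosing the parameter afterwards. A
    zero constant is treated separately since the argument divides by [form_bound b]. *)
Lemma form_int_CS X Y : mxL2 X -> mxL2 Y ->
  `|form_int b X Y| <=
    2 * form_bound b * (Num.sqrt (norm2_int X) * Num.sqrt (norm2_int Y)).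
Proof.
move=> hX hY; rewrite /form_int (le_trans (le_normr_Rintegral _ (mxL2_form hb hX hY)))//.
have [K0|Kp] := eqVneq (form_bound b) 0.
  rewrite K0 mulr0 mul0r (@eq_Rintegral _ _ _ _ _ (cst 0)).
    by rewrite /Rintegral integral0.
  move=> w _ /=; apply/eqP; rewrite normr_eq0 -normr_le0.
  by rewrite (le_trans (rbil_AMGM _ _ hb ltr01))// K0 mul0r.
have Kp' : 0 < form_bound b by rewrite lt_neqAle eq_sym Kp form_bound_ge0.
rewrite mulrAC mulrC -ler_pdivrMl//.
apply: le_sqrt_AMGM; rewrite ?norm2_int_ge0// => l l0.
rewrite ler_pdivrMl// /norm2_int -!RintegralZl//; try exact: mxL2_int.
rewrite -RintegralD//; try by apply: integrableZlR; exact: mxL2_int.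
rewrite -RintegralZl//; last first.
  by apply: integrableDR; apply: integrableZlR; exact: mxL2_int.
apply: le_Rintegral => //.
- exact: integrable_norm (mxL2_form hb hX hY).
- by apply: integrableZlR; apply: integrableDR; apply: integrableZlR; exact: mxL2_int.
- by move=> w _; exact: rbil_AMGM.
Qed.

End Form.

Lemma norm2_intN X : norm2_int (fun w => - X w) = norm2_int X.
Proof. by apply: eq_Rintegral => w _; rewrite hsnorm2N. Qed.

Lemma norm2_int_iZ X : norm2_int (fun w => 'i *: X w) = norm2_int X.
Proof. by apply: eq_Rintegral => w _; rewrite hsnorm2_iZ. Qed.

Lemma norm2_intZ r X : mxL2 X ->
  norm2_int (fun w => r%:C *: X w) = r ^+ 2 * norm2_int X.
Proof.
move=> hX; rewrite /norm2_int -RintegralZl//; last exact: mxL2_int.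
by apply: eq_Rintegral => w _; rewrite hsnorm2Z.
Qed.

Lemma norm2_intD_le X Y : mxL2 X -> mxL2 Y ->
  norm2_int (fun w => X w + Y w) <= 2 * norm2_int X + 2 * norm2_int Y.
Proof.
move=> hX hY; rewrite /norm2_int -!RintegralZl//; try exact: mxL2_int.
rewrite -RintegralD//; try by apply: integrableZlR; exact: mxL2_int.
apply: le_Rintegral => //.
- by apply: mxL2_int; exact: mxL2D.
- by apply: integrableDR; apply: integrableZlR; exact: mxL2_int.
- by move=> w _; exact: hsnorm2D_le.
Qed.

Lemma norm2_intB_le X Y : mxL2 X -> mxL2 Y ->
  norm2_int (fun w => X w - Y w) <= 2 * norm2_int X + 2 * norm2_int Y.
Proof. by move=> hX hY; rewrite -(norm2_intN Y) norm2_intD_le//; exact: mxL2N. Qed.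

Lemma norm2_int_cform X : mxL2 X ->
  norm2_int X = \sum_j form_int (cform (delta_mx j 0) 1%:M) X X.
Proof.
move=> hX; rewrite /norm2_int /form_int.
under eq_Rintegral do rewrite hsnorm2_cform.
by apply: Rintegral_sum => j; apply: mxL2_form => //; exact: cform_rbilinear.
Qed.

Definition L2cvg (X : nat -> S -> M) (Y : S -> M) : Prop :=
  (forall n, mxL2 (X n)) /\ mxL2 Y /\
  norm2_int (fun w => X n w - Y w) @[n --> \oo] --> 0.

Lemma sqrt_cvg0 (u : nat -> R) : u n @[n --> \oo] --> 0 ->
  Num.sqrt (u n) @[n --> \oo] --> 0.
Proof.
move=> u0; rewrite -[X in _ --> X]sqrtr0.
exact: (cvg_comp _ _ u0 (@sqrt_continuous R _)).
Qed.

Lemma L2cvg_cst X : mxL2 X -> L2cvg (fun=> X) X.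
Proof.
move=> hX; do 2 split=> //.
rewrite (_ : (fun n => _) = cst 0); first exact: cvg_cst.
apply/funext => n; rewrite /norm2_int.
under eq_Rintegral do rewrite subrr hsnorm20.
by rewrite /Rintegral integral0.
Qed.

(** The difference is split around the limits, so that besides the errors only the fixed norms of Y
    and Y' appear. *)
Lemma form_int_cvg b (X X' : nat -> S -> M) Y Y' : rbilinear b ->
  L2cvg X Y -> L2cvg X' Y' ->
  form_int b (X n) (X' n) @[n --> \oo] --> form_int b Y Y'.
Proof.
move=> hb [hX [hY cX]] [hX' [hY' cX']]; apply/subr_cvg0/norm_cvg0P.
pose e n : R := Num.sqrt (norm2_int (fun w => X n w - Y w)).
pose e' n : R := Num.sqrt (norm2_int (fun w => X' n w - Y' w)).
pose y : R := Num.sqrt (norm2_int Y); pose y' : R := Num.sqrt (norm2_int Y').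
have e0 : e n @[n --> \oo] --> 0 by exact: sqrt_cvg0.
have e'0 : e' n @[n --> \oo] --> 0 by exact: sqrt_cvg0.
pose u n := 2 * form_bound b * (e n * e' n + e n * y' + y * e' n).
apply: (@squeeze_cvgr _ _ _ _ (cst 0) u).
- near=> n; rewrite normr_ge0 /=.
  have hD : mxL2 (fun w => X n w - Y w) by exact: mxL2B.
  have hD' : mxL2 (fun w => X' n w - Y' w) by exact: mxL2B.
  have -> : form_int b (X n) (X' n) - form_int b Y Y' =
    form_int b (fun w => X n w - Y w) (fun w => X' n w - Y' w) +
    form_int b (fun w => X n w - Y w) Y' + form_int b Y (fun w => X' n w - Y' w).
    rewrite !(form_intBl hb) ?(form_intBr hb)//; lra.
  rewrite /u !mulrDr (le_trans (ler_normD _ _))// lerD ?form_int_CS//.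
  by rewrite (le_trans (ler_normD _ _))// lerD ?form_int_CS.
- exact: cvg_cst.
- rewrite /u -[X in _ --> X](mulr0 (2 * form_bound b)); apply: cvgM; first exact: cvg_cst.
  have -> : (0 : R) = 0 * 0 + 0 * y' + y * 0 by rewrite !(mulr0, mul0r, addr0).
  have c1 : e n * e' n @[n --> \oo] --> (0 * 0 : R) by exact: (cvgM e0 e'0).
  have c2 : e n * y' @[n --> \oo] --> (0 * y' : R) by exact: (cvgM e0 (cvg_cst y')).
  have c3 : y * e' n @[n --> \oo] --> (y * 0 : R) by exact: (cvgM (cvg_cst y) e'0).
  exact: cvgD (cvgD c1 c2) c3.
Unshelve. all: by end_near. Qed.

End L2.
End SquareIntegrable.

(** * Independence *)

Section ProductIntegral.
Context {R : realType} {d1 d2 : measure_display}.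
Context {T1 : measurableType d1} {T2 : measurableType d2}.
Variables (m1 : {sigma_finite_measure set T1 -> \bar R}).
Variables (m2 : {sigma_finite_measure set T2 -> \bar R}).
Variables (f : T1 -> R) (g : T2 -> R).
Hypothesis fi : m1.-integrable setT (EFin \o f).
Hypothesis gi : m2.-integrable setT (EFin \o g).

Lemma prod_integrable :
  (m1 \x m2)%E.-integrable setT (EFin \o (fun p : T1 * T2 => f p.1 * g p.2)).
Proof.
have /measurable_EFinP mf := measurable_int _ fi.
have /measurable_EFinP mg := measurable_int _ gi.
apply/integrable12ltyP.
  apply/measurable_EFinP; apply: measurable_funM.
    exact: measurableT_comp measurable_fst.
  exact: measurableT_comp measurable_snd.
have /integrableP[_ fo] := fi; have /integrableP[_ go] := gi.
have E x : (\int[m2]_y `|(EFin \o (fun p : T1 * T2 => f p.1 * g p.2)%R) (x, y)| =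
    `|(f x)%:E| * \int[m2]_y `|(g y)%:E|)%E.
  under eq_integral do rewrite /= normrM EFinM.
  by rewrite ge0_integralZl//; apply/measurable_EFinP; exact: measurableT_comp.
under eq_integral do rewrite E.
rewrite ge0_integralZr//; last 2 first.
- by apply/measurable_EFinP; exact: measurableT_comp.
- exact: integral_ge0.
apply: lte_mul_pinfty => //; first exact: integral_ge0.
by rewrite ge0_fin_numE// integral_ge0.
Qed.

Lemma prod_Rintegral :
  \int[(m1 \x m2)%E]_p (f p.1 * g p.2) = \int[m1]_x f x * \int[m2]_y g y.
Proof.
rewrite /Rintegral -(integral12_prod_meas1 prod_integrable) /fubini_F.
have E x : (\int[m2]_y (EFin \o (fun p : T1 * T2 => f p.1 * g p.2)%R) (x, y) =
    (f x)%:E * \int[m2]_y (g y)%:E)%E.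
  by under eq_integral do rewrite /= EFinM; rewrite integralZl.
rewrite [X in fine X = _](eq_integral (fun x => (f x)%:E * \int[m2]_y (g y)%:E)%E) => [|x _];
  last exact: E.
set K := (\int[m2]_y (g y)%:E)%E.
have Kf : K \is a fin_num by exact: integrable_fin_num.
by rewrite -(fineK Kf) integralZr// fineM//; exact: integrable_fin_num.
Qed.

End ProductIntegral.

Section Independence.
Context {d : measure_display} {T : measurableType d} {R : realType}.
Variable P : probability T R.

Definition independent_of (G1 G2 : set (set T)) : Prop :=
  forall B E, G1 B -> G2 E -> P (B `&` E) = (P B * P E)%E.

Definition gmeasurable (G : set (set T)) (f : T -> R) : Prop :=
  forall V : set R, measurable V -> G (f @^-1` V).

(** Filtrations are bare families of sets; passing to [g_sigma_algebraType] makes the closure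
    properties of [measurable_fun] available for each F_t. *)
Lemma gmeasurableP G (f : T -> R) : sigma_algebra setT G ->
  gmeasurable G f <-> measurable_fun setT (f : g_sigma_algebraType G -> R).
Proof.
move=> sG; split=> [h _ V mV|h V mV].
  by rewrite setTI; apply: sub_sigma_algebra; exact: h.
have := h measurableT V mV; rewrite setTI.
by rewrite /measurable/= (sigma_algebra_id sG).
Qed.

Lemma gmeasurable_measurable G (f : T -> R) : G `<=` measurable -> gmeasurable G f ->
  measurable_fun setT f.
Proof. by move=> sG h _ V mV; rewrite setTI; apply: sG; exact: h. Qed.

Section Product.
Variables (G1 G2 : set (set T)) (f g : T -> R).
Hypothesis indep : independent_of G1 G2.
Hypotheses (mf : gmeasurable G1 f) (mg : gmeasurable G2 g).
Hypothesis fi : P.-integrable setT (EFin \o f).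
Hypothesis gi : P.-integrable setT (EFin \o g).

Let mf' : measurable_fun setT f.
Proof. by apply/measurable_EFinP; exact: (measurable_int _ fi). Qed.
Let mg' : measurable_fun setT g.
Proof. by apply/measurable_EFinP; exact: (measurable_int _ gi). Qed.

Let X : {mfun T >-> R} := HB.pack f (isMeasurableFun.Build _ _ _ _ _ mf').
Let Y : {mfun T >-> R} := HB.pack g (isMeasurableFun.Build _ _ _ _ _ mg').
Let fg w := (f w, g w).
Let mfg : measurable_fun setT fg.
Proof. exact: measurable_fun_pair. Qed.
Let Z : {mfun T >-> (R * R)%type} := HB.pack fg (isMeasurableFun.Build _ _ _ _ _ mfg).

(** Independence is equality on rectangles, and rectangles determine the measure: the joint law is
    the product of the marginals. *)
Let joint A : measurable A ->
  (distribution P X \x distribution P Y)%E A = distribution P Z A.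
Proof.
apply: product_measure_unique => B C mB mC.
exact: (indep (mf mB) (mg mC)).
Qed.

Let h (p : R * R) : \bar R := (p.1 * p.2)%:E.
Let mh : measurable_fun setT h.
Proof. by apply/measurable_EFinP; apply: measurable_funM. Qed.

Let Xi : (distribution P X).-integrable setT (EFin \o id).
Proof. by apply: (integrable_pushforward mf') => //; exact: measurableT_comp. Qed.
Let Yi : (distribution P Y).-integrable setT (EFin \o id).
Proof. by apply: (integrable_pushforward mg') => //; exact: measurableT_comp. Qed.

(** Both factors are merely integrable; their product is so by Tonelli on the product of the laws.
    This matters for blocks, where |xi|^2 and the squared increment are each known to be integrable
    and nothing more. *)
Lemma independent_integrable : P.-integrable setT (EFin \o (fun w => f w * g w)).
Proof.
apply/integrableP; split.
  by apply/measurable_EFinP; exact: measurable_funM.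
have /integrableP[_] := prod_integrable Xi Yi.
rewrite (eq_measure_integral (distribution P Z)); last by move=> A mA _; exact: joint.
rewrite ge0_integral_distribution//.
by apply: measurableT_comp => //.
Qed.

Lemma independent_Rintegral :
  \int[P]_w (f w * g w) = \int[P]_w f w * \int[P]_w g w.
Proof.
have := prod_Rintegral Xi Yi; rewrite /Rintegral.
rewrite (eq_measure_integral (distribution P Z)); last by move=> A mA _; exact: joint.
rewrite integral_distribution//; last exact: independent_integrable.
by rewrite !integral_distribution.
Qed.

End Product.
End Independence.

(** * Increments of Hermitian Brownian motion *)

Section CenteredGaussian.
Context {R : realType}.

Lemma normal_prob_opp (s : R) (V : set R) : s != 0 -> measurable V ->
  normal_prob 0 s ((-%R : R -> R) @^-1` V) = normal_prob 0 s V.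
Proof.
move=> s0 mV; rewrite /normal_prob.
have mpdf : measurable_fun V (fun x : R => (normal_pdf 0 s x)%:E).
  by apply/measurable_EFinP; apply: measurable_funTS; exact: measurable_normal_pdf.
transitivity (\int[pushforward lebesgue_measure (-%R : _ -> measurableTypeR R)]_(x in V)
    (normal_pdf 0 s x)%:E)%E.
  rewrite ge0_integral_pushforward//=.
    by apply: eq_integral => x _ /=; rewrite !normal_pdfE// /normal_fun !subr0 sqrrN.
  by move=> x _; rewrite lee_fin normal_pdf_ge0.
by apply: eq_measure_integral => //= A mA _; exact: lebesgue_measureN.
Qed.

(** X and -X have the same law, since the density is even, so the mean equals its opposite. The
    almost surely zero case is the degenerate Gaussian. *)
Lemma centered_gaussian_mean {d} {T : measurableType d} (P : probability T R)
    (X : T -> R) :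
  centered_gaussian P X -> P.-integrable setT (EFin \o X) ->
  \int[P]_w X w = 0.
Proof.
move=> [mX hX] iX; case: hX => [X0|[s s0 lawX]].
  rewrite /Rintegral (ae_eq_integral (cst 0%E)) ?integral0//.
    exact/measurable_EFinP.
  by apply: filterS X0 => w -> _.
pose X' : {mfun T >-> R} := HB.pack X (isMeasurableFun.Build _ _ _ _ _ mX).
have mN : measurable_fun setT (fun w => - X w) by exact: measurable_funN.
pose N' : {mfun T >-> R} :=
  HB.pack (fun w => - X w) (isMeasurableFun.Build _ _ _ _ _ mN).
suff E : \int[P]_w X w = - \int[P]_w X w by move: E; lra.
rewrite -mulN1r -RintegralZl//.
under [RHS]eq_Rintegral do rewrite mulN1r.
have iN : P.-integrable setT (EFin \o (fun w => - X w)).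
  by have := integrableN iX; apply: eq_integrable.
rewrite /Rintegral; congr fine.
have <- : (\int[distribution P X']_y y%:E = \int[P]_w (X w)%:E)%E.
  by rewrite integral_distribution//; exact/measurable_EFinP.
have <- : (\int[distribution P N']_y y%:E = \int[P]_w (- X w)%:E)%E.
  by rewrite integral_distribution//; exact/measurable_EFinP.
apply: eq_measure_integral => A mA _.
have mNA : measurable ((-%R : R -> R) @^-1` A).
  by rewrite -[X in measurable X]setTI; exact: oppr_measurable.
exact: etrans (lawX _ mA) (etrans (esym (normal_prob_opp s0 mA)) (esym (lawX _ mNA))).
Qed.

End CenteredGaussian.

Section MatrixMeasurability.
Context {d : measure_display} {T : measurableType d} {R : realType} {N : nat}.
Implicit Types (X : T -> 'M[R[i]]_N) (G : set (set T)).

Lemma mx_measurable_coord G X :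
  mx_measurable G X <-> forall k, gmeasurable G (fun w => mxcoord k (X w)).
Proof.
split=> [h [[i j] b] V mV|h i j V mV]; first by case: b (h i j V mV) => -[].
by split; [exact: (h (i, j, false))|exact: (h (i, j, true))].
Qed.

Lemma mx_measurableP G X : sigma_algebra setT G ->
  mx_measurable G X <-> mxmeas (X : g_sigma_algebraType G -> 'M[R[i]]_N).
Proof.
move=> sG; rewrite mx_measurable_coord; split=> h k; exact/(gmeasurableP _ sG).
Qed.

Lemma mx_measurable_mxmeas G X : G `<=` measurable -> mx_measurable G X -> mxmeas X.
Proof.
by move=> sG /mx_measurable_coord h k; exact: gmeasurable_measurable sG (h k).
Qed.

Lemma mx_measurableS G G' X : G `<=` G' -> mx_measurable G X -> mx_measurable G' X.
Proof. by move=> sG h i j V mV; have [h1 h2] := h i j V mV; split; exact: sG. Qed.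

Lemma gmeasurable_rbil G (b : 'M[R[i]]_N -> 'M[R[i]]_N -> R) (X Y : T -> 'M[R[i]]_N) :
  sigma_algebra setT G -> rbilinear b ->
  mx_measurable G X -> mx_measurable G Y -> gmeasurable G (fun w => b (X w) (Y w)).
Proof.
move=> sG hb /(mx_measurableP _ sG) mX /(mx_measurableP _ sG) mY.
by apply/(gmeasurableP _ sG); exact: mxmeas_rbil.
Qed.

Lemma gmeasurable_hsnorm2 G X : sigma_algebra setT G -> mx_measurable G X ->
  gmeasurable G (fun w => hsnorm2 (X w)).
Proof.
move=> sG /(mx_measurableP _ sG) mX.
by apply/(gmeasurableP _ sG); exact: mxmeas_hsnorm2.
Qed.

Lemma mx_measurable_cst G (A : 'M[R[i]]_N) : sigma_algebra setT G ->
  mx_measurable G (fun=> A).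
Proof. by move=> sG; apply/(mx_measurableP _ sG); exact: mxmeas_cst. Qed.

Lemma mx_measurable_mul G (X Y : T -> 'M[R[i]]_N) : sigma_algebra setT G ->
  mx_measurable G X -> mx_measurable G Y -> mx_measurable G (fun w => X w *m Y w).
Proof.
move=> sG /(mx_measurableP _ sG) mX /(mx_measurableP _ sG) mY.
by apply/(mx_measurableP _ sG); exact: mxmeasM.
Qed.

Lemma mx_measurableB G (X Y : T -> 'M[R[i]]_N) : sigma_algebra setT G ->
  mx_measurable G X -> mx_measurable G Y -> mx_measurable G (fun w => X w - Y w).
Proof.
move=> sG /(mx_measurableP _ sG) mX /(mx_measurableP _ sG) mY.
by apply/(mx_measurableP _ sG); exact: mxmeasB.
Qed.

Lemma mx_measurable_sigma X : mx_measurable (mx_sigma X) X.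
Proof.
move=> i j V mV; split; apply: sub_sigma_algebra; exists i, j, V; split=> //; [by left|by right].
Qed.

Lemma Tform_rbilinear : rbilinear (@Tform R N).
Proof.
split=> [X Y Z|r X Y|X Y Z|r X Y]; rewrite /Tform.
- by rewrite mulmxDl linearD /= ReD mulrDr.
- by rewrite -scalemxAl linearZ /= ReZ mulrCA.
- by rewrite mulmxDr linearD /= ReD mulrDr.
- by rewrite -scalemxAr linearZ /= ReZ mulrCA.
Qed.

End MatrixMeasurability.

Section BrownianIncrements.
Context {d : measure_display} {T : measurableType d} {R : realType}.
Variable P : probability T R.
Context {N : nat}.
Local Notation M := 'M[R[i]]_N.
Variables (F : R -> set (set T)) (H : R -> T -> M).
Hypothesis hF : filtration F.
Hypothesis hH : hermitian_brownian_motion P H.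
Hypothesis hFH : brownian_relative_to P F H.
Hypothesis N0 : (0 < N)%N.

Lemma filt_sigma t : 0 <= t -> sigma_algebra setT (F t).
Proof. by case: hF => h _ t0; case: (h t t0). Qed.
Lemma filt_sub t : 0 <= t -> F t `<=` measurable.
Proof. by case: hF => h _ t0; case: (h t t0). Qed.
Lemma filt_le s t : 0 <= s -> s <= t -> F s `<=` F t.
Proof. by case: hF => _; apply. Qed.

Lemma hbm_herm t w : 0 <= t -> H t w \is hermsymmx.
Proof. by case: hH => h _ _ _ _; exact: h. Qed.
Lemma hbm_adapted t : 0 <= t -> mx_measurable (F t) (H t).
Proof. by case: hFH => h _; exact: h. Qed.
Lemma hbm_mxmeas t : 0 <= t -> mxmeas (H t).
Proof. by move=> t0; exact: mx_measurable_mxmeas (filt_sub t0) (hbm_adapted t0). Qed.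

Lemma Tform_hbm_meas (A : M) t : 0 <= t -> measurable_fun setT (fun w => Tform A (H t w)).
Proof.
move=> t0; apply: (mxmeas_rbil Tform_rbilinear); [exact: mxmeas_cst|exact: hbm_mxmeas].
Qed.

(** The covariance identity at A = B and s = t gives a finite value to the integral of a nonnegative
    function, which is integrability. *)
Lemma Tform_hbm_sqr_integrable (A : M) t : 0 <= t -> A \is hermsymmx ->
  P.-integrable setT (EFin \o (fun w => Tform A (H t w) ^+ 2)).
Proof.
move=> t0 hA; have [_ _ _ _ /(_ t t A A t0 t0 hA hA)] := hH.
rewrite unlock => cov; apply/integrableP; split.
  apply/measurable_EFinP; apply: measurable_funX; exact: Tform_hbm_meas.
under eq_integral do rewrite /= ger0_norm ?sqr_ge0// expr2.
by rewrite cov ltry.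
Qed.

Lemma sqr_integrable_mul (f g : T -> R) :
  measurable_fun setT f -> measurable_fun setT g ->
  P.-integrable setT (EFin \o (fun w => f w ^+ 2)) ->
  P.-integrable setT (EFin \o (fun w => g w ^+ 2)) ->
  P.-integrable setT (EFin \o (fun w => f w * g w)).
Proof.
move=> mf mg fi gi.
apply: (le_integrable measurableT _ _ (integrableDR fi gi)).
  by apply/measurable_EFinP; exact: measurable_funM.
move=> w _ /=; rewrite lee_fin (le_trans _ (ler_norm _))// ler_norml.
have := sqr_ge0 (f w - g w); have := sqr_ge0 (f w + g w).
have := sqr_ge0 (f w); have := sqr_ge0 (g w); rewrite !expr2 => *.
by apply/andP; split; lra.
Qed.

Lemma integrable_cstR (c : R) : P.-integrable setT (EFin \o (fun=> c)).
Proof. exact: finite_measure_integrable_cst. Qed.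

Lemma Tform_hbm_integrable (A : M) t : 0 <= t -> A \is hermsymmx ->
  P.-integrable setT (EFin \o (fun w => Tform A (H t w))).
Proof.
move=> t0 hA.
apply: (eq_integrable _ (EFin \o (fun w => Tform A (H t w) * 1))) => //.
  by move=> w _ /=; rewrite mulr1.
apply: (@sqr_integrable_mul _ (fun=> 1)).
- exact: Tform_hbm_meas.
- exact: measurable_cst.
- exact: Tform_hbm_sqr_integrable.
- exact: integrable_cstR.
Qed.

Lemma Tform_hbm_mean (A : M) t : 0 <= t -> A \is hermsymmx ->
  \int[P]_w Tform A (H t w) = 0.
Proof.
move=> t0 hA; apply: centered_gaussian_mean; last exact: Tform_hbm_integrable.
have [_ _ _ /(_ 1%N (fun=> t) (fun=> A) (fun=> t0) (fun=> hA)) + _] := hH.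
by under eq_fun do rewrite big_ord1.
Qed.

Lemma Tform_hbm_cov (A B : M) s t : 0 <= s -> 0 <= t ->
  A \is hermsymmx -> B \is hermsymmx ->
  \int[P]_w (Tform A (H s w) * Tform B (H t w)) = Num.min s t * Tform A B.
Proof.
move=> s0 t0 hA hB; have [_ _ _ _ /(_ s t A B s0 t0 hA hB)] := hH.
by rewrite unlock /Rintegral => ->.
Qed.

Section Increment.
Variables s t : R.
Hypotheses (s0 : 0 <= s) (st : s <= t).
Let t0 : 0 <= t. Proof. exact: le_trans st. Qed.

Definition frame_incr (k : 'I_N * 'I_N * bool) w : R := Tform (herm_frame k) (H t w - H s w).

Lemma frame_incrE k w :
  frame_incr k w = Tform (herm_frame k) (H t w) - Tform (herm_frame k) (H s w).
Proof. by have [_ _ hD _] := Tform_rbilinear (R := R) (N := N);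
  rewrite /frame_incr hD (rbilNr Tform_rbilinear). Qed.

Lemma frame_incr_integrable k : P.-integrable setT (EFin \o frame_incr k).
Proof.
apply: (eq_integrable _ (EFin \o (fun w => Tform (herm_frame k) (H t w) +
   -1 * Tform (herm_frame k) (H s w)))) => //.
  by move=> w _ /=; rewrite frame_incrE mulN1r.
apply: integrableDR; [|apply: integrableZlR]; apply: Tform_hbm_integrable => //; exact: herm_frameP.
Qed.

Lemma frame_incr_mean k : \int[P]_w frame_incr k w = 0.
Proof.
under eq_Rintegral do rewrite frame_incrE.
by rewrite RintegralB// ?Tform_hbm_mean ?subrr//; try exact: herm_frameP;
  apply: Tform_hbm_integrable => //; exact: herm_frameP.
Qed.

Let prod_int k l u v : 0 <= u -> 0 <= v -> P.-integrable setT
  (EFin \o (fun w => Tform (herm_frame k) (H u w) * Tform (herm_frame l) (H v w))).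
Proof.
move=> u0 v0; apply: sqr_integrable_mul; try exact: Tform_hbm_meas;
  apply: Tform_hbm_sqr_integrable => //; exact: herm_frameP.
Qed.

Let incr_mulE k l w : frame_incr k w * frame_incr l w =
  (Tform (herm_frame k) (H t w) * Tform (herm_frame l) (H t w) +
   -1 * (Tform (herm_frame k) (H t w) * Tform (herm_frame l) (H s w))) +
  (-1 * (Tform (herm_frame k) (H s w) * Tform (herm_frame l) (H t w)) +
   Tform (herm_frame k) (H s w) * Tform (herm_frame l) (H s w)).
Proof.
rewrite !frame_incrE; move: (Tform _ (H t w)) (Tform _ (H s w)) (Tform (herm_frame l) (H t w))
  (Tform (herm_frame l) (H s w)) => *; ring.
Qed.

Lemma frame_incr_mul_integrable k l :
  P.-integrable setT (EFin \o (fun w => frame_incr k w * frame_incr l w)).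
Proof.
apply: (eq_integrable measurableT _ _ (fun w _ => esym (congr1 EFin (incr_mulE k l w)))).
apply: integrableDR; apply: integrableDR; try apply: integrableZlR; exact: prod_int.
Qed.

Lemma frame_incr_cov k l :
  \int[P]_w (frame_incr k w * frame_incr l w) = (t - s) * Tform (herm_frame k) (herm_frame l).
Proof.
under eq_Rintegral do rewrite incr_mulE.
rewrite !RintegralD//; try (by apply: integrableDR; try apply: integrableZlR; exact: prod_int);
  try (by apply: integrableZlR; exact: prod_int); try exact: prod_int.
rewrite !RintegralZl//; try exact: prod_int.
rewrite !Tform_hbm_cov ?herm_frameP//.
(* min(t,t) - min(t,s) - min(s,t) + min(s,s) = t - s. *)
rewrite !minxx (min_r st) (min_l st); ring.
Qed.

Lemma increment_indep : independent_of P (F s) (mx_sigma (fun w => H t w - H s w)).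
Proof. by case: hFH => _ h; exact: h. Qed.

Lemma mx_sigma_sigma : sigma_algebra setT (mx_sigma (fun w => H t w - H s w)).
Proof. exact: smallest_sigma_algebra. Qed.

Lemma frame_incr_gmeasurable k : gmeasurable (mx_sigma (fun w => H t w - H s w)) (frame_incr k).
Proof.
apply: (gmeasurable_rbil mx_sigma_sigma Tform_rbilinear).
  exact: mx_measurable_cst mx_sigma_sigma.
exact: mx_measurable_sigma.
Qed.

Lemma frame_incr_mul_gmeasurable k l :
  gmeasurable (mx_sigma (fun w => H t w - H s w)) (fun w => frame_incr k w * frame_incr l w).
Proof.
apply/(gmeasurableP _ mx_sigma_sigma); apply: measurable_funM;
  apply/(gmeasurableP _ mx_sigma_sigma); exact: frame_incr_gmeasurable.
Qed.

(** Separates the random scalars, independent of F_s, from matrices that are F_s-measurable as soon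
    as the integrand is. *)
Lemma increment_expand w (X : M) : (H t w - H s w) *m X =
  \sum_k ((4 * N%:R)^-1 * frame_incr k w)%:C *: (herm_frame k *m X).
Proof.
have hh : H t w - H s w \is hermsymmx.
  apply: adj_herm; rewrite linearB /= map_mxB.
  by rewrite (herm_adj (hbm_herm w t0)) (herm_adj (hbm_herm w s0)).
rewrite {1}(herm_frame_expand N0 hh) mulmx_suml; apply: eq_bigr => k _.
by rewrite -scalemxAl.
Qed.

Section Integrand.
Variable xi : T -> M.
Hypotheses (mxi : mx_measurable (F s) xi) (Lxi : mxL2 P xi).

Lemma frame_adapted k : mx_measurable (F s) (fun w => herm_frame k *m xi w).
Proof.
apply: mx_measurable_mul (filt_sigma s0) _ mxi.
exact: mx_measurable_cst (filt_sigma s0).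
Qed.

(** The squared norm is an F_s-measurable integrable function times a squared increment independent
    of F_s. *)
Lemma frame_incr_L2 k : mxL2 P (fun w => (frame_incr k w)%:C *: (herm_frame k *m xi w)).
Proof.
have L : mxL2 P (fun w => herm_frame k *m xi w) by exact: mxL2_constMl.
apply: (@mxL2_le _ _ _ _ _ _
  (fun w => hsnorm2 (herm_frame k *m xi w) * (frame_incr k w * frame_incr k w))).
- apply: mxmeas_scaler; last by case: L.
  by apply/measurable_EFinP; exact: (measurable_int _ (frame_incr_integrable k)).
- apply: (independent_integrable increment_indep).
  + exact: (gmeasurable_hsnorm2 (filt_sigma s0) (frame_adapted k)).
  + exact: frame_incr_mul_gmeasurable.
  + exact: mxL2_int.
  + exact: frame_incr_mul_integrable.
- by move=> w; rewrite hsnorm2Z mulrC expr2.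
Qed.

Lemma block_adapted : mx_measurable (F t) (fun w => (H t w - H s w) *m xi w).
Proof.
apply: mx_measurable_mul (filt_sigma t0) _ _; last exact: mx_measurableS (filt_le s0 st) mxi.
apply: mx_measurableB (filt_sigma t0) (hbm_adapted t0) _.
exact: mx_measurableS (filt_le s0 st) (hbm_adapted s0).
Qed.

Lemma block_L2 : mxL2 P (fun w => (H t w - H s w) *m xi w).
Proof.
have -> : (fun w => (H t w - H s w) *m xi w) =
   (fun w => \sum_k ((4 * N%:R)^-1)%:C *: ((frame_incr k w)%:C *: (herm_frame k *m xi w))).
  apply/funext => w; rewrite increment_expand; apply: eq_bigr => k _.
  by rewrite scalerA; congr (_ *: _); exact: rmorphM.
by apply: mxL2_sum => k; apply: mxL2Z; exact: frame_incr_L2.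
Qed.

(** Each term of the expansion is an F_s-measurable function times an independent centered
    increment, so its expectation factors and vanishes. *)
Lemma block_orthogonal b Z : rbilinear b -> mx_measurable (F s) Z -> mxL2 P Z ->
  form_int P b Z (fun w => (H t w - H s w) *m xi w) = 0.
Proof.
move=> hb mZ LZ; rewrite /form_int.
have E w : b (Z w) ((H t w - H s w) *m xi w) =
   \sum_k (4 * N%:R)^-1 * (b (Z w) (herm_frame k *m xi w) * frame_incr k w).
  rewrite increment_expand (rbil_sumr hb); apply: eq_bigr => k _.
  by case: hb => _ _ _ ->; ring.
under eq_Rintegral do rewrite E.
have Lk k : mxL2 P (fun w => herm_frame k *m xi w) by exact: mxL2_constMl.
have gb k := gmeasurable_rbil (filt_sigma s0) hb mZ (frame_adapted k).
have ii k := independent_integrable increment_indep (gb k) (frame_incr_gmeasurable k)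
  (mxL2_form hb LZ (Lk k)) (frame_incr_integrable k).
rewrite Rintegral_sum; last by move=> k; exact: integrableZlR.
apply: big1 => k _; rewrite RintegralZl//.
rewrite (independent_Rintegral increment_indep (gb k) (frame_incr_gmeasurable k)
  (mxL2_form hb LZ (Lk k)) (frame_incr_integrable k)).
by rewrite frame_incr_mean !mulr0.
Qed.

End Integrand.

(** Independence factors the expectation of each term, the covariance supplies (t - s) T(Q_k, Q_l)
    with Q_k = [herm_frame k], and the Casimir identity performs the sum. *)
Lemma block_isometry psi A (xi eta : T -> M) : A \is hermsymmx ->
  mx_measurable (F s) xi -> mxL2 P xi -> mx_measurable (F s) eta -> mxL2 P eta ->
  form_int P (cform psi A) (fun w => (H t w - H s w) *m xi w)
                           (fun w => (H t w - H s w) *m eta w) =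
  (complex.Re (\tr A) / N%:R) * ((t - s) * form_int P (cform psi 1%:M) xi eta).
Proof.
move=> hA mxi Lxi meta Leta; rewrite /form_int.
have hb := cform_rbilinear psi A.
pose b k l w := cform psi A (herm_frame k *m xi w) (herm_frame l *m eta w).
have E w : cform psi A ((H t w - H s w) *m xi w) ((H t w - H s w) *m eta w) =
   \sum_k \sum_l (4 * N%:R)^-1 ^+ 2 * (b k l w * (frame_incr k w * frame_incr l w)).
  rewrite increment_expand (rbil_suml hb); apply: eq_bigr => k _.
  rewrite increment_expand (rbil_sumr hb); apply: eq_bigr => l _.
  by case: hb => _ hl _ hr; rewrite hl hr /b; ring.
under eq_Rintegral do rewrite E.
have Lk k : mxL2 P (fun w => herm_frame k *m xi w) by exact: mxL2_constMl.
have Ll k : mxL2 P (fun w => herm_frame k *m eta w) by exact: mxL2_constMl.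
have gb k l : gmeasurable (F s) (b k l) :=
  gmeasurable_rbil (filt_sigma s0) hb (frame_adapted mxi k) (frame_adapted meta l).
have bi k l : P.-integrable setT (EFin \o b k l) by exact: mxL2_form.
have ii k l := independent_integrable increment_indep (gb k l) (frame_incr_mul_gmeasurable k l)
  (bi k l) (frame_incr_mul_integrable k l).
have ii2 k l : P.-integrable setT
    (EFin \o (fun w => (4 * N%:R)^-1 ^+ 2 * (b k l w * (frame_incr k w * frame_incr l w)))).
  exact: integrableZlR.
rewrite Rintegral_sum; last by move=> k; exact: integrable_sumR.
under eq_bigr => k _ do rewrite Rintegral_sum//.
under eq_bigr => k _ do under eq_bigr => l _ do
  rewrite RintegralZl// (independent_Rintegral increment_indep (gb k l)
    (frame_incr_mul_gmeasurable k l)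
  (bi k l) (frame_incr_mul_integrable k l)) frame_incr_cov.
rewrite mulrCA -RintegralZl//; last by apply: mxL2_form => //; exact: cform_rbilinear.
(* The Casimir identity is used from right to left under the integral, so that both sides become
   sums over the same pairs. *)
under [in RHS]eq_Rintegral do rewrite -(cform_casimir _ _ _ N0 hA).
have ib k l : P.-integrable setT (EFin \o (fun w => (4 * N%:R)^-1 ^+ 2 *
   Tform (herm_frame k) (herm_frame l) * b k l w)) by exact: integrableZlR.
rewrite Rintegral_sum; last by move=> k; exact: integrable_sumR.
rewrite mulr_sumr; apply: eq_bigr => k _.
rewrite Rintegral_sum// mulr_sumr; apply: eq_bigr => l _.
rewrite [in RHS]RintegralZl; [|by []|exact: bi].
have -> : \int[P]_x cform psi A (herm_frame k *m xi x) (herm_frame l *m eta x) =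
  \int[P]_w b k l w by [].
ring.
Qed.

End Increment.
End BrownianIncrements.

(** * The Ito isometry *)

Section SimpleIntegral.
Context {d : measure_display} {T : measurableType d} {R : realType}.
Variable P : probability T R.
Context {N : nat}.
Local Notation M := 'M[R[i]]_N.
Variables (F : R -> set (set T)) (H : R -> T -> M).
Hypothesis hF : filtration F.
Hypothesis hH : hermitian_brownian_motion P H.
Hypothesis hFH : brownian_relative_to P F H.
Hypothesis N0 : (0 < N)%N.

Local Notation mu := (@lebesgue_measure R).
Local Notation ST := (measurableTypeR R * T)%type.
Local Notation muP := (mu \x P)%E.

Definition indic_co (a b : R) (x : R) : R := \1_(`[a, b[%classic) x.

Lemma indic_coE a b x : indic_co a b x = (a <= x < b)%R%:R.
Proof. by rewrite /indic_co indicE mem_setE in_itv. Qed.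

Definition block_process a b (xi : T -> M) (p : ST) : M := (indic_co a b p.1)%:C *: xi p.2.

Lemma indic_co_integrable a b : mu.-integrable setT (EFin \o indic_co a b).
Proof. exact: integrable_indic_itv. Qed.

Lemma indic_co_measurable a b : measurable_fun setT (indic_co a b : measurableTypeR R -> R).
Proof. by apply: measurable_indic; exact: measurable_itv. Qed.

(** Length of the intersection of [a, b[ and [c, e[; the outer maximum covers disjoint intervals. *)
Definition overlap (a b c e : R) : R := Num.max 0 (Num.min b e - Num.max a c).

Lemma indic_co_mul a b c e x : indic_co a b x * indic_co c e x =
  indic_co (Num.max a c) (Num.min b e) x.
Proof.
rewrite !indic_coE -natrM mulnb ge_max lt_min; congr (nat_of_bool _)%:R.
by case: (a <= x); case: (c <= x); case: (x < b); case: (x < e).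
Qed.

Lemma Rintegral_indic_co a b : \int[mu]_x indic_co a b x = Num.max 0 (b - a).
Proof.
rewrite /Rintegral integral_indic//= setIT lebesgue_measure_itv /= lte_fin.
case: ltP => ab /=; first by rewrite max_r// subr_ge0 ltW.
by rewrite max_l// subr_le0.
Qed.

Lemma Rintegral_indic_co_mul a b c e : \int[mu]_x (indic_co a b x * indic_co c e x) =
  overlap a b c e.
Proof. by under eq_Rintegral do rewrite indic_co_mul; rewrite Rintegral_indic_co. Qed.

Lemma block_process_mxmeas a b xi : mxmeas xi -> mxmeas (block_process a b xi).
Proof.
move=> mxi; apply: mxmeas_scaler.
  exact: measurableT_comp (indic_co_measurable a b) measurable_fst.
by move=> k; exact: measurableT_comp (mxi k) measurable_snd.
Qed.

Lemma block_process_L2 a b xi : mxL2 P xi -> mxL2 muP (block_process a b xi).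
Proof.
move=> Lxi; apply: (mxL2_le (f := fun p : ST => indic_co a b p.1 * hsnorm2 (xi p.2))).
- by apply: block_process_mxmeas; case: Lxi.
- apply: (@prod_integrable _ _ _ _ _ mu P (indic_co a b) (fun w => hsnorm2 (xi w))).
    exact: indic_co_integrable.
  exact: mxL2_int.
- move=> p; rewrite /block_process hsnorm2Z indic_coE.
  by case: (_ <= _ < _); rewrite ?expr1n ?expr0n.
Qed.

Lemma form_int_block_process b (xi eta : T -> M) a1 a2 c1 c2 : rbilinear b ->
  mxL2 P xi -> mxL2 P eta ->
  form_int muP b (block_process a1 a2 xi) (block_process c1 c2 eta) =
  overlap a1 a2 c1 c2 * form_int P b xi eta.
Proof.
move=> hb Lxi Leta; rewrite -Rintegral_indic_co_mul /form_int.
rewrite -(@prod_Rintegral _ _ _ _ _ mu P (fun x => indic_co a1 a2 x * indic_co c1 c2 x)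
  (fun w => b (xi w) (eta w))).
- apply: eq_Rintegral => p _; rewrite /block_process.
  by case: hb => _ -> _ ->; rewrite mulrA.
- rewrite (_ : (fun x => _) = indic_co (Num.max a1 c1) (Num.min a2 c2)).
    exact: indic_co_integrable.
  by apply/funext => x; exact: indic_co_mul.
- exact: mxL2_form.
Qed.

Lemma form_int_sym {d'} {S : measurableType d'} (m : {measure set S -> \bar R})
    psi A (X Y : S -> M) : A \is hermsymmx ->
  form_int m (cform psi A) X Y = form_int m (cform psi A) Y X.
Proof. by move=> hA; apply: eq_Rintegral => w _; exact: cform_sym. Qed.

Lemma herm_mx1 : (1%:M : M) \is hermsymmx.
Proof. by apply: adj_herm; rewrite trmx1 map_mx1. Qed.

Definition normalized_trace (A : M) : R := complex.Re (\tr A) / N%:R.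

Lemma normalized_trace1 : normalized_trace 1%:M = 1.
Proof.
rewrite /normalized_trace mxtrace1 (_ : complex.Re N%:R = N%:R :> R).
  by rewrite divff// pnatr_eq0 -lt0n.
by elim: (N) => // n IH; rewrite !mulrSr ReD IH.
Qed.

Local Notation adapted t X := (mx_measurable (F t) X).
Local Notation block a b xi := (fun w => (H b w - H a w) *m xi w).

Let adapted_le s t (X : T -> M) : 0 <= s -> s <= t -> adapted s X -> adapted t X.
Proof. move=> s0 st; apply: mx_measurableS; exact: (filt_le hF). Qed.

Let bL2 := block_L2 hF hH hFH N0.
Let borth := block_orthogonal hF hH hFH N0.
Let badapt := block_adapted hF hFH.

Lemma block_split a b c (xi : T -> M) :
  block a b xi = (fun w => block a c xi w + block c b xi w).
Proof. by apply/funext => w; rewrite -mulmxDl; congr (_ *m _); rewrite [RHS]addrC addrA subrK. Qed.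

(** The part of the longer block after b is orthogonal to everything known at time b, in particular
    to the shorter block. *)
Lemma block_isometry_same_start psi A a b c (xi eta : T -> M) : A \is hermsymmx ->
  0 <= a -> a <= b -> b <= c -> adapted a xi -> mxL2 P xi -> adapted a eta -> mxL2 P eta ->
  form_int P (cform psi A) (block a b xi) (block a c eta) =
  normalized_trace A * ((b - a) * form_int P (cform psi 1%:M) xi eta).
Proof.
move=> hA a0 ab bc mxi Lxi meta Leta.
have b0 : 0 <= b by exact: le_trans ab.
have meta' : adapted b eta by exact: adapted_le meta.
rewrite (block_split a c b) (form_intDr (cform_rbilinear _ _)); try exact: bL2.
rewrite [X in _ + X]borth ?addr0//; first exact: (block_isometry hF hH hFH N0).
- exact: cform_rbilinear.
- exact: badapt.
- exact: bL2.
Qed.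

(* Both increments are split at the end points of the other interval; by orthogonality only the
   overlap contributes. *)
Lemma block_isometry_le psi A a b c e (xi eta : T -> M) : A \is hermsymmx ->
  0 <= a -> a <= b -> a <= c -> c <= e ->
  adapted a xi -> mxL2 P xi -> adapted c eta -> mxL2 P eta ->
  form_int P (cform psi A) (block a b xi) (block c e eta) =
  normalized_trace A * (overlap a b c e * form_int P (cform psi 1%:M) xi eta).
Proof.
move=> hA a0 ab ac ce mxi Lxi meta Leta.
have c0 : 0 <= c by exact: le_trans ac.
have mxi' : adapted c xi by exact: adapted_le mxi.
have hb := cform_rbilinear psi A.
rewrite /overlap (max_r ac).
have [bc|cb] := leP b c.
  rewrite borth//; last 2 first.
  - by apply: (adapted_le _ bc); [exact: le_trans ab|exact: badapt].
  - exact: bL2.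
  rewrite max_l ?mul0r ?mulr0//.
  by rewrite subr_le0 (le_trans _ bc)// ge_min lexx.
rewrite (block_split a b c) (form_intDl hb); try (apply: bL2 => //; exact: ltW).
rewrite [X in X + _]borth//; last 2 first.
- exact: badapt.
- exact: bL2.
rewrite add0r max_r; last by rewrite subr_ge0 le_min ce ltW.
have [be|eb] := leP b e.
  by rewrite block_isometry_same_start// ltW.
(* Here the second interval ends first: by symmetry the shorter block is moved to the left. *)
rewrite form_int_sym// (form_int_sym _ _ xi eta herm_mx1).
by rewrite block_isometry_same_start// ltW.
Qed.

Lemma overlapC a b c e : overlap a b c e = overlap c e a b.
Proof. by rewrite /overlap (minC b) (maxC a). Qed.

Lemma block_isometry_gen psi A a b c e (xi eta : T -> M) : A \is hermsymmx ->
  0 <= a -> a <= b -> 0 <= c -> c <= e ->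
  adapted a xi -> mxL2 P xi -> adapted c eta -> mxL2 P eta ->
  form_int P (cform psi A) (block a b xi) (block c e eta) =
  normalized_trace A * form_int muP (cform psi 1%:M) (block_process a b xi) (block_process c e eta).
Proof.
move=> hA a0 ab c0 ce mxi Lxi meta Leta.
rewrite form_int_block_process//; last exact: cform_rbilinear.
have [ac|ca] := leP a c; first exact: block_isometry_le.
rewrite form_int_sym// (form_int_sym _ _ xi eta herm_mx1) overlapC.
by apply: block_isometry_le => //; exact: ltW.
Qed.

(* [simple_integral V X]: the elementary process [V] has stochastic integral [X]. *)
Inductive simple_integral : (ST -> M) -> (T -> M) -> Prop :=
| simple_integral0 : simple_integral (fun=> 0) (fun=> 0)
| simple_integral_block a b xi V X : 0 <= a -> a <= b -> adapted a xi -> mxL2 P xi ->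
    simple_integral V X ->
    simple_integral (fun p => V p + block_process a b xi p) (fun w => X w + block a b xi w).

Lemma simple_integral_L2 V X : simple_integral V X -> mxL2 muP V /\ mxL2 P X.
Proof.
elim=> [|a b xi {}V {}X a0 ab mxi Lxi _ [LV LX]].
  by split; exact: mxL20.
by split; apply: mxL2D => //; [exact: block_process_L2|exact: bL2].
Qed.

(** The inner half of a double induction: the isometry is bilinear in the pair of integrals, so it
    reduces to pairs of blocks. Pairs are unavoidable since the square of a sum has cross terms. *)
Lemma simple_integral_block_isometry psi A a b xi V X : A \is hermsymmx ->
  0 <= a -> a <= b -> adapted a xi -> mxL2 P xi -> simple_integral V X ->
  form_int P (cform psi A) (block a b xi) X =
  normalized_trace A * form_int muP (cform psi 1%:M) (block_process a b xi) V.
Proof.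
move=> hA a0 ab mxi Lxi.
have hb B := cform_rbilinear psi B.
elim=> [|c e eta {}V {}X c0 ce meta Leta hVX IH].
  by rewrite !form_int0r// mulr0.
have [LV LX] := simple_integral_L2 hVX.
rewrite !form_intDr//; try exact: bL2; try exact: block_process_L2.
by rewrite IH block_isometry_gen// mulrDr.
Qed.

Lemma simple_integral_isometry psi A V X V' X' : A \is hermsymmx ->
  simple_integral V X -> simple_integral V' X' ->
  form_int P (cform psi A) X X' = normalized_trace A * form_int muP (cform psi 1%:M) V V'.
Proof.
move=> hA hVX hVX'; have hb B := cform_rbilinear psi B.
have [LV' LX'] := simple_integral_L2 hVX'.
elim: hVX => [|c e eta {}V {}X c0 ce meta Leta hVX IH].
  by rewrite !form_int0l// mulr0.
have [LV LX] := simple_integral_L2 hVX.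
rewrite !form_intDl//; try exact: bL2; try exact: block_process_L2.
by rewrite IH (simple_integral_block_isometry _ hA c0 ce meta Leta hVX') mulrDr.
Qed.

Lemma simple_integral_norm V X : simple_integral V X -> norm2_int P X = norm2_int muP V.
Proof.
move=> h; have [LV LX] := simple_integral_L2 h.
rewrite !norm2_int_cform//; apply: eq_bigr => j _.
by rewrite (simple_integral_isometry _ herm_mx1 h h) normalized_trace1 mul1r.
Qed.

Lemma simple_integralD V X V' X' : simple_integral V X -> simple_integral V' X' ->
  simple_integral (fun p => V p + V' p) (fun w => X w + X' w).
Proof.
move=> h; elim=> [|a b xi {}V' {}X' a0 ab mxi Lxi h' IH].
  by under eq_fun do rewrite addr0; under [X in simple_integral _ X]eq_fun do rewrite addr0.
have := simple_integral_block a0 ab mxi Lxi IH.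
by under eq_fun do rewrite -addrA; under [X in simple_integral _ X]eq_fun do rewrite -addrA.
Qed.

Lemma mx_measurableN t (X : T -> M) : 0 <= t -> adapted t X -> adapted t (fun w => - X w).
Proof.
move=> t0 mX; have := mx_measurableB (filt_sigma hF t0)
  (mx_measurable_cst 0 (filt_sigma hF t0)) mX.
by under eq_fun do rewrite sub0r.
Qed.

Lemma simple_integralN V X : simple_integral V X ->
  simple_integral (fun p => - V p) (fun w => - X w).
Proof.
elim=> [|a b xi {}V {}X a0 ab mxi Lxi h IH].
  by under eq_fun do rewrite oppr0; under [X in simple_integral _ X]eq_fun do rewrite oppr0;
     exact: simple_integral0.
have := simple_integral_block a0 ab (mx_measurableN a0 mxi) (mxL2N Lxi) IH.
rewrite (_ : (fun p => _) = (fun p => - (V p + block_process a b xi p))); last first.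
  by apply/funext => p; rewrite opprD /block_process scalerN.
rewrite (_ : (fun w => - X w + _) = (fun w => - (X w + block a b xi w)))//.
by apply/funext => w; rewrite opprD mulmxN.
Qed.

(* Against an F_s-measurable Z only the part of the integral before time s counts. *)
Lemma simple_integral_truncate V X s : 0 <= s -> simple_integral V X ->
  exists V' X', [/\ simple_integral V' X',
    forall p, V' p = if p.1 < s then V p else 0 &
    forall b Z, rbilinear b -> adapted s Z -> mxL2 P Z ->
      form_int P b Z X = form_int P b Z X'].
Proof.
move=> s0; elim=> [|a b xi {}V {}X a0 ab mxi Lxi h [V' [X' [h' VV' XX']]]].
  by exists (fun=> 0), (fun=> 0); split=> //; [exact: simple_integral0|move=> p; case: ifP].
have [LV LX] := simple_integral_L2 h; have [LV' LX'] := simple_integral_L2 h'.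
have [sa|as_] := leP s a.
  exists V', X'; split=> // [p|c Z hc mZ LZ].
    rewrite VV'; case: ifP => // ps; rewrite /block_process indic_coE.
    by rewrite (leNgt a) (lt_le_trans ps sa) /= scale0r addr0.
  rewrite form_intDr//; last exact: bL2.
  by rewrite XX'// borth ?addr0//; exact: adapted_le mZ.
(* A block that begins before s is cut at s: its part on [s, b[ starts at s and is therefore
   orthogonal to Z. *)
have am : a <= Num.min b s by rewrite le_min ab ltW.
exists (fun p => V' p + block_process a (Num.min b s) xi p),
  (fun w => X' w + block a (Num.min b s) xi w).
split=> [|p|c Z hc mZ LZ]; first exact: simple_integral_block.
  rewrite VV' /block_process !indic_coE lt_min; case: ifP => ps; first by rewrite andbT.
  by rewrite !andbF scale0r addr0.
have s0' : a <= s by exact: ltW.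
have a0m : 0 <= Num.min b s by exact: le_trans am.
have L1 := bL2 a0 ab mxi Lxi.
have L2 := bL2 a0 am mxi Lxi.
rewrite (form_intDr hc LZ LX L1) (form_intDr hc LZ LX' L2) (XX' c Z hc mZ LZ).
suff -> : form_int P c Z (block a b xi) = form_int P c Z (block a (Num.min b s) xi) by [].
have [bs|sb] := leP b s; first by [].
have sb' := ltW sb.
have mxi' : adapted s xi by exact: adapted_le mxi.
have L3 := bL2 a0 s0' mxi Lxi.
have L4 := bL2 s0 sb' mxi' Lxi.
by rewrite (block_split a b s) (form_intDr hc LZ L3 L4) (borth s0 sb' mxi' Lxi hc mZ LZ) addr0.
Qed.

End SimpleIntegral.

Section L2Limits.
Context {d : measure_display} {S : measurableType d} {R : realType} {N : nat}.
Local Notation M := 'M[R[i]]_N.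
Variable m : {measure set S -> \bar R}.
Implicit Types X Y : S -> M.

Lemma norm2_int_le X Y : mxL2 m X -> mxL2 m Y ->
  (forall w, hsnorm2 (X w) <= hsnorm2 (Y w)) -> norm2_int m X <= norm2_int m Y.
Proof. by move=> LX LY le; apply: le_Rintegral => //; exact: mxL2_int. Qed.

Lemma L2cvgB (Xn Yn : nat -> S -> M) X Y : L2cvg m Xn X -> L2cvg m Yn Y ->
  L2cvg m (fun n w => Xn n w - Yn n w) (fun w => X w - Y w).
Proof.
move=> [LXn [LX cX]] [LYn [LY cY]]; split=> [n|]; first exact: mxL2B.
split; first exact: mxL2B.
pose u n : R := 2 * norm2_int m (fun w => Xn n w - X w) +
                2 * norm2_int m (fun w => Yn n w - Y w).
apply: (@squeeze_cvgr _ _ _ _ (cst 0) u).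
- near=> n; rewrite norm2_int_ge0 /=.
  rewrite (_ : (fun w => _) = (fun w => (Xn n w - X w) - (Yn n w - Y w))).
    by apply: norm2_intB_le; exact: mxL2B.
  by apply/funext => w; apply/matrixP => i j; rewrite !mxE; ring.
- exact: cvg_cst.
- have c1 : 2 * norm2_int m (fun w => Xn n w - X w) @[n --> \oo] --> (2 * 0 : R).
    exact: (cvgM (cvg_cst (2 : R)) cX).
  have c2 : 2 * norm2_int m (fun w => Yn n w - Y w) @[n --> \oo] --> (2 * 0 : R).
    exact: (cvgM (cvg_cst (2 : R)) cY).
  rewrite [X in _ --> X](_ : (0 : R) = 2 * 0 + 2 * 0); last by rewrite !mulr0 addr0.
  exact: cvgD c1 c2.
Unshelve. all: by end_near. Qed.

End L2Limits.

(** * Passage to the L^2 limit *)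

Section ItoIntegral.
Context {d : measure_display} {T : measurableType d} {R : realType}.
Variable P : probability T R.
Context {N : nat}.
Local Notation M := 'M[R[i]]_N.
Variables (F : R -> set (set T)) (H : R -> T -> M).
Hypothesis hF : filtration F.
Hypothesis hH : hermitian_brownian_motion P H.
Hypothesis hFH : brownian_relative_to P F H.
Hypothesis N0 : (0 < N)%N.

Local Notation mu := (@lebesgue_measure R).
Local Notation ST := (measurableTypeR R * T)%type.
Local Notation muP := (mu \x P)%E.
Local Notation simple_integral := (simple_integral P F H).

(** The closure of [simple_integral] in L^2. It carries no final time, so integrals up to different
    times can be subtracted. *)
Definition ito_limit (V : ST -> M) (X : T -> M) : Prop :=
  exists Vn Xn, [/\ forall n, simple_integral (Vn n) (Xn n), L2cvg muP Vn V & L2cvg P Xn X].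

Lemma ito_limit_L2 V X : ito_limit V X -> mxL2 muP V /\ mxL2 P X.
Proof. by move=> [Vn [Xn [_ [_ [LV _]] [_ [LX _]]]]]. Qed.

Lemma ito_limit_isometry psi A V X : A \is hermsymmx -> ito_limit V X ->
  form_int P (cform psi A) X X = normalized_trace A * form_int muP (cform psi 1%:M) V V.
Proof.
move=> hA [Vn [Xn [hs cV cX]]].
have c1 := form_int_cvg (cform_rbilinear psi A) cX cX.
have c2 := form_int_cvg (cform_rbilinear psi 1%:M) cV cV.
have c3 : normalized_trace A * form_int muP (cform psi 1%:M) (Vn n) (Vn n) @[n --> \oo] -->
    (normalized_trace A * form_int muP (cform psi 1%:M) V V : R).
  by apply: cvgM => //; exact: cvg_cst.
have E : (fun n => form_int P (cform psi A) (Xn n) (Xn n)) =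
    (fun n => normalized_trace A * form_int muP (cform psi 1%:M) (Vn n) (Vn n)).
  by apply/funext => n; exact: (simple_integral_isometry hF hH hFH N0).
rewrite E in c1; exact: cvg_unique c1 c3.
Qed.

Lemma ito_limit_norm V X : ito_limit V X -> norm2_int P X = norm2_int muP V.
Proof.
move=> h; have [LV LX] := ito_limit_L2 h.
rewrite !norm2_int_cform//; apply: eq_bigr => j _.
by rewrite (ito_limit_isometry _ (@herm_mx1 R N) h) normalized_trace1// mul1r.
Qed.

Lemma ito_limitB V X V' X' : ito_limit V X -> ito_limit V' X' ->
  ito_limit (fun p => V p - V' p) (fun w => X w - X' w).
Proof.
move=> [Vn [Xn [hs cV cX]]] [Vn' [Xn' [hs' cV' cX']]].
exists (fun n p => Vn n p - Vn' n p), (fun n w => Xn n w - Xn' n w); split.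
- by move=> n; exact: simple_integralD (hs n) (simple_integralN hF (hs' n)).
- exact: L2cvgB.
- exact: L2cvgB.
Qed.

(** The approximants need not vanish before s. Once truncated at s they are at most |Vn - V|
    pointwise, because V = 0 there, so Cauchy-Schwarz and the isometry make the pairing tend to
    0. *)
Lemma ito_limit_orthogonal b V X Z s : rbilinear b -> ito_limit V X -> 0 <= s ->
  (forall p : ST, p.1 < s -> V p = 0) -> mx_measurable (F s) Z -> mxL2 P Z ->
  form_int P b Z X = 0.
Proof.
move=> hb [Vn [Xn [hs cV cX]]] s0 V0 mZ LZ.
have c1 := form_int_cvg hb (L2cvg_cst LZ) cX.
have [LVn [LV cV0]] := cV.
pose u n : R := 2 * form_bound b * (Num.sqrt (norm2_int P Z) *
  Num.sqrt (norm2_int muP (fun p => Vn n p - V p))).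
have c2 : u n @[n --> \oo] --> 0.
  have c3 : Num.sqrt (norm2_int P Z) * Num.sqrt (norm2_int muP (fun p => Vn n p - V p))
     @[n --> \oo] --> (Num.sqrt (norm2_int P Z) * 0 : R).
    by apply: cvgM; [exact: cvg_cst|exact: sqrt_cvg0].
  have : u n @[n --> \oo] --> (2 * form_bound b * (Num.sqrt (norm2_int P Z) * 0) : R).
    exact: (cvgM (cvg_cst (2 * form_bound b : R)) c3).
  by rewrite !mulr0.
suff c0 : form_int P b Z (Xn n) @[n --> \oo] --> (0 : R) by exact: cvg_unique c1 c0.
apply/norm_cvg0P.
apply: (@squeeze_cvgr _ _ _ _ (cst 0) u) => //; last exact: cvg_cst.
near=> n; rewrite normr_ge0 /=.
have [V' [X' [h' VV' XX']]] := simple_integral_truncate hF hH hFH N0 s0 (hs n).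
have [LV' LX'] := simple_integral_L2 hF hH hFH N0 h'.
rewrite XX'//; apply: (le_trans (form_int_CS hb LZ LX')).
rewrite ler_wpM2l ?mulr_ge0 ?form_bound_ge0// ler_wpM2l ?sqrtr_ge0//.
rewrite ler_sqrt ?norm2_int_ge0// (simple_integral_norm hF hH hFH N0 h').
apply: norm2_int_le => //; first exact: mxL2B.
move=> p; rewrite VV'; case: ifP => ps; first by rewrite (V0 p ps) subr0.
by rewrite hsnorm20 hsnorm2_ge0.
Unshelve. all: by end_near. Qed.

Section Elementary.
Variables (t : R) (phi : @elementary _ T R N).
Hypothesis hphi : elementary_process P F t phi.

Lemma el_time_ge0 k : (k <= el_size phi)%N -> 0 <= el_time phi k.
Proof.
case: hphi => e0 _ mono _; elim: k => [|k IH] hk; first by rewrite e0.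
by rewrite (le_trans (IH (ltnW hk)))// mono.
Qed.

Lemma el_time_le k : (k <= el_size phi)%N -> el_time phi k <= t.
Proof.
case: hphi => _ et mono _.
(* Induction downwards from the last time, which is t. *)
have H' j : (j <= el_size phi)%N -> el_time phi (el_size phi - j) <= t.
  elim: j => [|j IH] hj; first by rewrite subn0 et.
  apply: le_trans (IH (ltnW hj)).
  have -> : (el_size phi - j = (el_size phi - j.+1).+1)%N by rewrite subnSK.
  by apply: mono; rewrite ltn_subrL (leq_trans _ hj).
by move=> hk; have := H' (el_size phi - k)%N (leq_subr _ _); rewrite subKn.
Qed.

Lemma elementary_simple_integral :
  simple_integral (fun p => elementary_at phi p.1 p.2) (elementary_integral H phi).
Proof.
have [_ _ mono hval] := hphi.
pose at_ n (p : ST) : M :=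
  \sum_(k < n | el_time phi k <= p.1 < el_time phi k.+1) el_val phi k p.2.
pose int_ n w : M :=
  \sum_(k < n) (H (el_time phi k.+1) w - H (el_time phi k) w) *m el_val phi k w.
suff K n : (n <= el_size phi)%N -> simple_integral (at_ n) (int_ n) by exact: K.
elim: n => [|n IH] hn.
  rewrite (_ : at_ 0%N = fun=> 0); last by apply/funext => p; rewrite /at_ big_ord0.
  rewrite (_ : int_ 0%N = fun=> 0); last by apply/funext => p; rewrite /int_ big_ord0.
  exact: simple_integral0.
have t0 := el_time_ge0 (ltnW hn); have [mv iv] := hval n hn.
have Lv : mxL2 P (el_val phi n).
  by split=> //; exact: mx_measurable_mxmeas (filt_sub hF t0) mv.
have -> : int_ n.+1 = (fun w => int_ n w +
    (H (el_time phi n.+1) w - H (el_time phi n) w) *m el_val phi n w).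
  by apply/funext => w; rewrite /int_ big_ord_recr.
have -> : at_ n.+1 = (fun p => at_ n p +
    block_process (el_time phi n) (el_time phi n.+1) (el_val phi n) p).
  apply/funext => p; rewrite /at_ big_mkcond big_ord_recr -big_mkcond /=.
  by congr (_ + _); rewrite /block_process indic_coE; case: ifP; rewrite ?scale1r ?scale0r.
exact: simple_integral_block t0 (mono n hn) mv Lv (IH (ltnW hn)).
Qed.

(** Lets integrals over [0, t] be replaced by integrals over the whole line, since [slice_cc]
    vanishes outside as well. *)
Lemma elementary_at_out s w : ~~ (0 <= s <= t) -> elementary_at phi s w = 0.
Proof.
move=> hs; apply: big1 => k /andP[k1 k2]; move: hs.
have h1 := el_time_ge0 (ltnW (ltn_ord k)); have h2 := el_time_le (ltn_ord k).
by rewrite (le_trans h1 k1) (ltW (lt_le_trans k2 h2)).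
Qed.

End Elementary.

(** Extension by 0 to the whole line, so that one product measure serves all intervals. The closed
    interval [0, t] is the one in the definition of the integral; the difference of two slices
    starting at 0 is a [slice_oc]. *)
Definition slice_cc (s t : R) (Y : R -> T -> M) (p : ST) : M :=
  if s <= p.1 <= t then Y p.1 p.2 else 0.

Lemma integral_prod_iterated (f : ST -> R) : measurable_fun setT f -> (forall p, 0 <= f p) ->
  (\int[muP]_p (f p)%:E = \int[P]_w \int[mu]_s (f (s, w))%:E)%E.
Proof.
move=> mf f0; rewrite (fubini_tonelli2 (EFin \o f))//; exact/measurable_EFinP.
Qed.

Lemma hsnorm2_slice_cc_int s t (Y : R -> T -> M) w :
  (\int[mu]_r (hsnorm2 (slice_cc s t Y (r, w)))%:E =
   \int[mu]_(r in `[s, t]) (hsnorm2 (Y r w))%:E)%E.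
Proof.
rewrite [RHS]integral_mkcond; apply: eq_integral => r _.
rewrite /slice_cc patchE mem_setE in_itv /=; case: ifP => //.
by rewrite hsnorm20.
Qed.

Lemma ito_integrand_meas t Y : ito_integrand P F t Y -> mxmeas (slice_cc 0 t Y).
Proof.
move=> [mY _ _].
have mD : measurable ((`[0%R, t]%classic : set (measurableTypeR R)) `*` (setT : set T)).
  by apply: measurableX => //; exact: measurable_itv.
move=> k.
have : measurable_fun ((`[0%R, t]%classic : set (measurableTypeR R)) `*` (setT : set T))
   (fun p : ST => mxcoord k (Y p.1 p.2)).
  by case: k => [[i j] [|]]; have [] := mY i j.
move/(measurable_restrictT _ mD); apply: eq_measurable_fun => p _.
rewrite patchE /slice_cc in_setX in_setT andbT mem_setE in_itv /=; case: ifP => //.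
by move=> _; case: k => [[i j] [|]]; rewrite /mxcoord mxE.
Qed.

Lemma ito_integrand_L2 t Y : ito_integrand P F t Y -> mxL2 muP (slice_cc 0 t Y).
Proof.
move=> h; have mc := ito_integrand_meas h; split=> //.
rewrite integral_prod_iterated//; last 2 first.
- exact: mxmeas_hsnorm2.
- by move=> p; exact: hsnorm2_ge0.
under eq_integral do rewrite hsnorm2_slice_cc_int.
by case: h.
Qed.

Lemma is_ito_integral_limit t Y X : is_ito_integral P F H t Y X -> ito_limit (slice_cc 0 t Y) X.
Proof.
move=> [hY mX [phi [hphi cV cX]]].
exists (fun n p => elementary_at (phi n) p.1 p.2), (fun n => elementary_integral H (phi n)).
have hs n := elementary_simple_integral (hphi n).
have LY := ito_integrand_L2 hY.
have Ls n := simple_integral_L2 hF hH hFH N0 (hs n).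
split=> //.
- split=> [n|]; first by case: (Ls n).
  split=> //; move: cV => /fine_cvgP[_]; apply: cvg_trans; apply: near_eq_cvg.
  near=> n; rewrite /= /norm2_int /Rintegral; congr fine.
  have Ln : mxL2 muP (fun p => elementary_at (phi n) p.1 p.2 - slice_cc 0 t Y p).
    by apply: mxL2B => //; case: (Ls n).
  have E := integral_prod_iterated (mxmeas_hsnorm2 (proj1 Ln)) (fun p => hsnorm2_ge0 _).
  refine (etrans _ (esym E)).
  apply: eq_integral => w _; rewrite [LHS]integral_mkcond; apply: eq_integral => s _.
  rewrite patchE mem_setE in_itv /= /slice_cc /=; case: ifP => h.
    by rewrite -hsnorm2N opprB.
  by rewrite (elementary_at_out (hphi n)) ?h// subr0 hsnorm20.
- have mX' : mxmeas X by exact: mx_measurable_mxmeas mX.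
  have LX : mxL2 P X.
    (* Square integrability of X is derived: convergence to 0 forces a finite distance to some
       elementary integral, which is itself square integrable. *)
    have [n _ /(_ n (leqnn n)) fin_n] := cvg_is_fine cX.
    have [_ LI] := Ls n.
    have LD : mxL2 P (fun w => X w - elementary_integral H (phi n) w).
      split; first by apply: mxmeasB => //; case: LI.
      rewrite -ge0_fin_numE//; apply: integral_ge0 => w _.
      by rewrite lee_fin hsnorm2_ge0.
    by have := mxL2D LD LI; under eq_fun do rewrite subrK.
  split=> [n|]; first by case: (Ls n).
  split=> //; move: cX => /fine_cvgP[_]; apply: cvg_trans; apply: near_eq_cvg.
  near=> n; rewrite /= /norm2_int /Rintegral; congr fine.
  by apply: eq_integral => w _; rewrite -hsnorm2N opprB.
Unshelve. all: by end_near. Qed.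

End ItoIntegral.

(** * The time integral *)

Section TimeIntegrals.
Context {R : realType} {N : nat}.
Local Notation M := 'M[R[i]]_N.
Local Notation mu := (@lebesgue_measure R).

Lemma mxcoordN k (X : M) : mxcoord k (- X) = - mxcoord k X.
Proof. by rewrite /mxcoord mxE; case: k.2; case: (X _ _). Qed.

(** This is the nonnegativity of the integral of (f - c)^2, with c the mean of f over ]s, t]. The
    interval of length 0 comes first, as c divides by t - s. *)
Lemma time_CS (s t : R) (f : R -> R) : s <= t ->
  mu.-integrable `]s, t] (EFin \o f) ->
  mu.-integrable `]s, t] (EFin \o (fun x => f x ^+ 2)) ->
  (\int[mu]_(x in `]s, t]) f x) ^+ 2 <= (t - s) * \int[mu]_(x in `]s, t]) (f x ^+ 2).
Proof.
rewrite le_eqVlt => /predU1P[<-|st] fi f2i.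
  by rewrite set_itv_ge ?bnd_simp ?ltxx// !Rintegral_set0 expr0n mulr0.
have h0 : 0 < t - s by rewrite subr_gt0.
set a := \int[mu]_(x in `]s, t]) f x; set c := a / (t - s).
have mI : measurable (`]s, t]%classic : set (measurableTypeR R)) by exact: measurable_itv.
have ci (k : R) : mu.-integrable `]s, t] (EFin \o (fun=> k)).
  apply/integrableP; split; first exact: measurable_cst.
  by rewrite integral_cst//= lebesgue_measure_itv /= lte_fin st -EFinB -EFinM ltry.
have e0 : 0 <= \int[mu]_(x in `]s, t]) ((f x - c) ^+ 2).
  by apply: Rintegral_ge0 => x _; exact: sqr_ge0.
have fZ (k : R) : mu.-integrable `]s, t] (EFin \o (fun x => k * f x)).
  exact: (integrableZl mI k fi).
have E : \int[mu]_(x in `]s, t]) ((f x - c) ^+ 2) =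
   \int[mu]_(x in `]s, t]) (f x ^+ 2) + (- (2 * c) * a + c ^+ 2 * (t - s)).
  rewrite (@eq_Rintegral _ _ _ _ _
    (fun x : measurableTypeR R => f x ^+ 2 + (- (2 * c) * f x + c ^+ 2))).
    rewrite RintegralD//; last first.
      by have := integrableD mI (fZ (- (2 * c))) (ci (c ^+ 2)); apply: eq_integrable.
    congr (_ + _); rewrite RintegralD// RintegralZl//; congr (_ + _).
    by rewrite Rintegral_cst//= lebesgue_measure_itv /= lte_fin st.
  by move=> x _; ring.
move: e0; rewrite E.
have -> : - (2 * c) * a + c ^+ 2 * (t - s) = - (a ^+ 2 / (t - s)).
  by rewrite /c; field; rewrite gt_eqF.
by rewrite subr_ge0 ler_pdivrMr// mulrC.
Qed.

(** Stated in extended reals so that it can be integrated over the probability space by Tonelli. *)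
Lemma hsnorm2_time_CS (Y : R -> M) (J : M) s t : s <= t ->
  (forall k, mu.-integrable `]s, t] (EFin \o (fun r => mxcoord k (Y r)))) ->
  (forall k, mu.-integrable `]s, t] (EFin \o (fun r => mxcoord k (Y r) ^+ 2))) ->
  (forall k, mxcoord k J = \int[mu]_(r in `]s, t]) mxcoord k (Y r)) ->
  ((hsnorm2 J)%:E <= (t - s)%:E * \int[mu]_(r in `]s, t]) (hsnorm2 (Y r))%:E)%E.
Proof.
move=> st Yi Y2i hJ.
have mI : measurable (`]s, t]%classic : set (measurableTypeR R)) by exact: measurable_itv.
have si r' : mu.-integrable `]s, t] (EFin \o (fun r => \sum_(k <- r') mxcoord k (Y r) ^+ 2)).
  elim: r' => [|k r' IH].
    by apply: (eq_integrable _ (cst 0%E)) => //;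
      [move=> w _ /=; rewrite big_nil|exact: integrable0].
  have := integrableD mI (Y2i k) IH; apply: eq_integrable => // w _ /=.
  by rewrite big_cons.
have -> : (\int[mu]_(r in `]s, t]) (hsnorm2 (Y r))%:E =
    (\sum_k \int[mu]_(r in `]s, t]) (mxcoord k (Y r) ^+ 2))%:E)%E.
  under eq_integral do rewrite hsnorm2E.
  rewrite -[LHS]fineK; last exact: (integrable_fin_num mI (si _)).
  congr EFin; rewrite -/(Rintegral _ _ _).
  elim: (index_enum _) => [|k r' IH].
    rewrite big_nil (@eq_Rintegral _ _ _ _ _ (cst 0)); last by move=> x _; rewrite big_nil.
    by rewrite Rintegral_cst// mul0r.
  rewrite big_cons -IH -RintegralD//.
  by apply: eq_Rintegral => x _; rewrite big_cons.
rewrite -EFinM lee_fin hsnorm2E mulr_sumr; apply: ler_sum => k _.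
by rewrite hJ; exact: time_CS.
Qed.

End TimeIntegrals.

Section Paths.
Context {d : measure_display} {T : measurableType d} {R : realType} {N : nat}.
Local Notation M := 'M[R[i]]_N.
Local Notation mu := (@lebesgue_measure R).
Variable U : R -> T -> M.
Hypothesis cU : continuous_process U.

Lemma path_within k w (t : R) :
  {within `[0, t], continuous (fun r => mxcoord k (U r w))}.
Proof.
have : {within `[0, +oo[, continuous (fun r => mxcoord k (U r w))}.
  by case: k => [[i j] [|]]; have [] := cU w i j.
apply: continuous_subspaceW => x /=; rewrite !in_itv /= andbT.
by case/andP.
Qed.

Lemma path_integrable0 k w (t : R) :
  mu.-integrable `[0, t] (EFin \o (fun r => mxcoord k (U r w))).
Proof.
apply: continuous_compact_integrable; first exact: segment_compact.
exact: path_within.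
Qed.

Lemma path_integrable k w (s t : R) : 0 <= s ->
  mu.-integrable `]s, t] (EFin \o (fun r => mxcoord k (U r w))).
Proof.
move=> s0; apply: integrableS (path_integrable0 k w t) => //.
by move=> x /=; rewrite !in_itv /= => /andP[/ltW/(le_trans s0) -> ->].
Qed.

Lemma path_sqr_integrable k w (s t : R) : 0 <= s ->
  mu.-integrable `]s, t] (EFin \o (fun r => mxcoord k (U r w) ^+ 2)).
Proof.
have sq : mu.-integrable `[0, t] (EFin \o (fun r => mxcoord k (U r w) ^+ 2)).
  apply: continuous_compact_integrable; first exact: segment_compact.
  apply: (@within_continuous_comp _ _ _ _ (fun r => mxcoord k (U r w))
    (fun y : R => y ^+ 2)); last exact: path_within.
  by move=> y _; exact: exprn_continuous.
move=> s0; apply: integrableS sq => //.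
by move=> x /=; rewrite !in_itv /= => /andP[/ltW/(le_trans s0) -> ->].
Qed.

Lemma mxcoord_time_integral k (t : R) w :
  mxcoord k (time_integral t U w) = \int[mu]_(r in `[0, t]) mxcoord k (U r w).
Proof. by case: k => [[i j] [|]]; rewrite /mxcoord /time_integral mxE. Qed.

Lemma mxcoord_time_integralB k (s t : R) w : 0 <= s -> s <= t ->
  mxcoord k (time_integral t U w - time_integral s U w) =
  \int[mu]_(r in `]s, t]) mxcoord k (U r w).
Proof.
move=> s0 st; rewrite mxcoordD mxcoordN !mxcoord_time_integral.
apply: (@Rintegral_itvB _ (fun r => mxcoord k (U r w)) (BLeft 0) (BRight t) s);
  rewrite ?bnd_simp//.
exact: path_integrable0.
Qed.

Lemma time_integral_CS s t w : 0 <= s -> s <= t ->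
  ((hsnorm2 (time_integral t U w - time_integral s U w))%:E <=
  (t - s)%:E * \int[mu]_(r in `]s, t]) (hsnorm2 (U r w))%:E)%E.
Proof.
move=> s0 st; apply: (hsnorm2_time_CS (Y := fun r => U r w)) => // k.
- exact: path_integrable.
- exact: path_sqr_integrable.
- exact: mxcoord_time_integralB.
Qed.

(** The left side is the squared norm of int_s^t (U_r - U_s) dr, the error of the left-endpoint
    rule. Once U_r - U_s is known to be small, this gains one power of t - s over
    [time_integral_CS]. *)
Lemma time_integral_remainder_CS s t w : 0 <= s -> s <= t ->
  ((hsnorm2 (time_integral t U w - time_integral s U w - (t - s)%:C *: U s w))%:E <=
  (t - s)%:E * \int[mu]_(r in `]s, t]) (hsnorm2 (U r w - U s w))%:E)%E.
Proof.
move=> s0 st.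
have mI : measurable (`]s, t]%classic : set (measurableTypeR R)) by exact: measurable_itv.
have muI : mu `]s, t] = (t - s)%:E.
  rewrite lebesgue_measure_itv /= lte_fin; case: ltP => // ts.
  by rewrite (_ : t - s = 0)//; apply/eqP; rewrite subr_eq0 eq_le st ts.
have ci (k : R) : mu.-integrable `]s, t] (EFin \o (fun=> k)).
  apply/integrableP; split; first exact: measurable_cst.
  by rewrite integral_cst//= muI -EFinM ltry.
have sB k r : mxcoord k (U r w - U s w) = mxcoord k (U r w) + - mxcoord k (U s w).
  by rewrite mxcoordD mxcoordN.
apply: (hsnorm2_time_CS (Y := fun r => U r w - U s w)) => // k.
- have := integrableD mI (path_integrable k w t s0) (ci (- mxcoord k (U s w))).
  by apply: eq_integrable => // r _ /=; rewrite sB.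
- have i1 := path_sqr_integrable k w t s0.
  have i2 := integrableZl mI (- (2 * mxcoord k (U s w))) (path_integrable k w t s0).
  have := integrableD mI i1 (integrableD mI i2 (ci (mxcoord k (U s w) ^+ 2))).
  apply: eq_integrable => // r _ /=; rewrite sB -EFinM -!EFinD; congr EFin; ring.
- have -> : \int[mu]_(r in `]s, t]) mxcoord k (U r w - U s w) =
      \int[mu]_(r in `]s, t]) (mxcoord k (U r w) + - mxcoord k (U s w)).
    by apply: eq_Rintegral => r _; rewrite sB.
  rewrite RintegralD//; last exact: path_integrable.
  rewrite Rintegral_cst//= muI /= mxcoordD mxcoord_time_integralB//; congr (_ + _).
  by rewrite mxcoordN mxcoordZ; ring.
Qed.

End Paths.

Section TimeSlices.
Context {d : measure_display} {T : measurableType d} {R : realType}.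
Variable P : probability T R.
Context {N : nat}.
Local Notation M := 'M[R[i]]_N.
Local Notation mu := (@lebesgue_measure R).
Local Notation ST := (measurableTypeR R * T)%type.
Local Notation muP := (mu \x P)%E.

Definition slice_oc (s t : R) (Y : R -> T -> M) (p : ST) : M :=
  if s < p.1 <= t then Y p.1 p.2 else 0.

Lemma form_int_le {d'} {S : measurableType d'} (m : {measure set S -> \bar R})
    (b : M -> M -> R) (X Y : S -> M) (x y : R) :
  rbilinear b -> mxL2 m X -> mxL2 m Y -> 0 <= x -> 0 <= y ->
  norm2_int m X <= x ^+ 2 -> norm2_int m Y <= y ^+ 2 ->
  `|form_int m b X Y| <= 2 * form_bound b * (x * y).
Proof.
move=> hb LX LY x0 y0 hx hy; apply: (le_trans (form_int_CS hb LX LY)).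
rewrite ler_wpM2l ?mulr_ge0 ?form_bound_ge0// ler_pM ?sqrtr_ge0//.
  by rewrite -(ger0_norm x0) -sqrtr_sqr ler_sqrt ?sqr_ge0.
by rewrite -(ger0_norm y0) -sqrtr_sqr ler_sqrt ?sqr_ge0.
Qed.

Lemma lebesgue_measure_oc (s t : R) : s <= t -> mu `]s, t] = (t - s)%:E.
Proof.
move=> st; rewrite lebesgue_measure_itv /= lte_fin; case: ltP => // ts.
by rewrite (_ : t - s = 0)//; apply/eqP; rewrite subr_eq0 eq_le st ts.
Qed.

Definition indic_oc (s t x : R) : R := \1_(`]s, t]%classic) x.

Lemma indic_ocE s t x : indic_oc s t x = (s < x <= t)%R%:R.
Proof. by rewrite /indic_oc indicE mem_setE in_itv. Qed.

Lemma indic_oc_integrable s t : mu.-integrable setT (EFin \o indic_oc s t).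
Proof. exact: integrable_indic_itv. Qed.

Lemma Rintegral_indic_oc s t : s <= t -> \int[mu]_x indic_oc s t x = t - s.
Proof. by move=> st; rewrite /Rintegral integral_indic//= setIT lebesgue_measure_oc. Qed.

Lemma slice_oc_cstE s t Z : slice_oc s t (fun=> Z) = (fun p => (indic_oc s t p.1)%:C *: Z p.2).
Proof.
by apply/funext => p; rewrite /slice_oc indic_ocE; case: ifP; rewrite ?scale1r ?scale0r.
Qed.

Lemma slice_oc_cst_L2 s t Z : mxL2 P Z -> mxL2 muP (slice_oc s t (fun=> Z)).
Proof.
move=> LZ; rewrite slice_oc_cstE.
apply: (mxL2_le (f := fun p : ST => indic_oc s t p.1 * hsnorm2 (Z p.2))).
- apply: mxmeas_scaler.
    apply: measurableT_comp measurable_fst.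
    by apply: measurable_indic; exact: measurable_itv.
  by case: LZ => mZ _ k; exact: measurableT_comp (mZ k) measurable_snd.
- apply: (@prod_integrable _ _ _ _ _ mu P (indic_oc s t) (fun w => hsnorm2 (Z w))).
    exact: indic_oc_integrable.
  exact: mxL2_int.
- move=> p; rewrite hsnorm2Z indic_ocE.
  by case: (_ < _ <= _); rewrite ?expr1n ?expr0n.
Qed.

Lemma form_int_slice_oc_cst b s t Z : rbilinear b -> mxL2 P Z -> s <= t ->
  form_int muP b (slice_oc s t (fun=> Z)) (slice_oc s t (fun=> Z)) = (t - s) * form_int P b Z Z.
Proof.
move=> hb LZ st; rewrite -(Rintegral_indic_oc st) /form_int slice_oc_cstE.
rewrite -(@prod_Rintegral _ _ _ _ _ mu P (indic_oc s t) (fun w => b (Z w) (Z w))).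
- apply: eq_Rintegral => p _; case: hb => _ -> _ ->; rewrite indic_ocE.
  by case: (_ < _ <= _); rewrite ?mul1r ?mul0r.
- exact: indic_oc_integrable.
- exact: mxL2_form.
Qed.

(** Tonelli with the time integral outside: the bound K applies at each r, and ]s, t] has length t -
    s. *)
Lemma slice_oc_norm_le (Y : R -> T -> M) s t K : s <= t -> 0 <= K ->
  mxL2 muP (slice_oc s t Y) ->
  (forall r, s < r -> r <= t -> mxL2 P (Y r) /\ norm2_int P (Y r) <= K) ->
  norm2_int muP (slice_oc s t Y) <= K * (t - s).
Proof.
move=> st K0 LV hY.
pose f (p : ST) := (hsnorm2 (slice_oc s t Y p))%:E.
have mf : measurable_fun setT f.
  by apply/measurable_EFinP; apply: mxmeas_hsnorm2; case: LV.
have f0 p : (0 <= f p)%E by rewrite lee_fin hsnorm2_ge0.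
rewrite -lee_fin -mxL2_norm2// -/f (fubini_tonelli1 f mf f0).
have -> : (K * (t - s))%:E = (\int[mu]_x (K * indic_oc s t x)%:E)%E.
  rewrite -(Rintegral_indic_oc st) -RintegralZl//; last exact: indic_oc_integrable.
  rewrite fineK//; apply: integrable_fin_num => //.
  exact: (integrableZl measurableT K (indic_oc_integrable s t)).
apply: ge0_le_integral => //.
- by move=> x _; apply: integral_ge0 => w _; exact: f0.
- exact: measurable_fun_fubini_tonelli_F.
- apply/measurable_EFinP; apply: measurable_funM => //.
  by apply: measurable_indic; exact: measurable_itv.
- move=> r _; rewrite /fubini_F indic_ocE.
  have [/andP[sr rt]|out] := boolP (s < r <= t).
    have [LY le] := hY r sr rt.
    rewrite (eq_integral (fun w => (hsnorm2 (Y r w))%:E)); last first.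
      by move=> w _; rewrite /f /slice_oc /= sr rt.
    by rewrite mxL2_norm2// lee_fin mulr1.
  rewrite (eq_integral (cst 0%E)); first by rewrite integral0 mulr0.
  by move=> w _; rewrite /f /slice_oc /= (negbTE out) hsnorm20.
Qed.

(** Integrating the pathwise bound by Tonelli yields the square integrability of [E] along with the
    estimate. *)
Lemma ae_time_bound (E : T -> M) (Y : R -> T -> M) s t : s <= t ->
  mxmeas E -> mxL2 muP (slice_oc s t Y) ->
  {ae P, forall w, ((hsnorm2 (E w))%:E <=
    (t - s)%:E * \int[mu]_(r in `]s, t]) (hsnorm2 (Y r w))%:E)%E} ->
  mxL2 P E /\ norm2_int P E <= (t - s) * norm2_int muP (slice_oc s t Y).
Proof.
move=> st mE LV hE; have h0 : 0 <= t - s by rewrite subr_ge0.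
pose f (p : ST) := (hsnorm2 (slice_oc s t Y p))%:E.
have mf : measurable_fun setT f.
  by apply/measurable_EFinP; apply: mxmeas_hsnorm2; case: LV.
have f0 p : (0 <= f p)%E by rewrite lee_fin hsnorm2_ge0.
have bnd : (\int[P]_w (hsnorm2 (E w))%:E <= ((t - s) * norm2_int muP (slice_oc s t Y))%:E)%E.
  rewrite EFinM -mxL2_norm2// -/f (fubini_tonelli2 f mf f0) -ge0_integralZl//; last 2 first.
  - exact: measurable_fun_fubini_tonelli_G.
  - by move=> w _; apply: integral_ge0 => r _; exact: f0.
  apply: ae_ge0_le_integral => //.
  - by move=> w _; rewrite lee_fin hsnorm2_ge0.
  - by apply/measurable_EFinP; exact: mxmeas_hsnorm2.
  - move=> w _; apply: mule_ge0; first by rewrite lee_fin.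
    by apply: integral_ge0 => r _; exact: f0.
  - by apply: measurable_funeM; exact: measurable_fun_fubini_tonelli_G.
  - apply: filterS hE => w le _; apply: (le_trans le).
    rewrite le_eqVlt; apply/orP; left; apply/eqP; congr (_ * _)%E.
    rewrite [LHS]integral_mkcond; apply: eq_integral => r _.
    rewrite patchE mem_setE in_itv /= /f /slice_oc /=; case: ifP => // _.
    by rewrite hsnorm20.
have LE : mxL2 P E by split=> //; exact: le_lt_trans bnd (ltry _).
by split=> //; rewrite -lee_fin -mxL2_norm2.
Qed.

End TimeSlices.

(** * Increments of unitary Brownian motion *)

Section UnitaryBrownianMotion.
Context {d : measure_display} {T : measurableType d} {R : realType}.
Variable P : probability T R.
Context {N : nat}.
Local Notation M := 'M[R[i]]_N.
Variables (F : R -> set (set T)) (H U : R -> T -> M).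
Hypothesis hF : filtration F.
Hypothesis hH : hermitian_brownian_motion P H.
Hypothesis hFH : brownian_relative_to P F H.
Hypothesis hU : unitary_brownian_motion P F H U.
Hypothesis N0 : (0 < N)%N.

Local Notation mu := (@lebesgue_measure R).
Local Notation ST := (measurableTypeR R * T)%type.
Local Notation muP := (mu \x P)%E.

Let cU : continuous_process U. Proof. by case: hU. Qed.

Lemma ubm_adapted t : 0 <= t -> mx_measurable (F t) (U t).
Proof. by case: hU => _ h _ _; exact: h. Qed.

Lemma ubm_mxmeas t : 0 <= t -> mxmeas (U t).
Proof. by move=> t0; exact: mx_measurable_mxmeas (filt_sub hF t0) (ubm_adapted t0). Qed.

Lemma half_realC : (2^-1 : R[i]) = (2^-1)%:C.
Proof.
apply: (mulfI (x := 2)); first by rewrite pnatr_eq0.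
rewrite divff ?pnatr_eq0//; apply/eqP; rewrite eq_complex /=.
by apply/andP; split; apply/eqP; field.
Qed.

Lemma ubm_increment s t : 0 <= s -> s <= t ->
  exists DX D, [/\ ito_limit P F H (slice_oc s t U) DX, mxmeas D,
    forall w, U t w = U s w + ('i *: DX w + (- 2^-1)%:C *: D w) &
    {ae P, forall w, D w = time_integral t U w - time_integral s U w}].
Proof.
move=> s0 st; have t0 : 0 <= t by exact: le_trans st.
have [_ _ _ eqU] := hU.
have [Xs iXs es] := eqU s s0; have [Xt iXt et] := eqU t t0.
have Is := is_ito_integral_limit hF hH hFH N0 iXs.
have It := is_ito_integral_limit hF hH hFH N0 iXt.
have IX := ito_limitB hF It Is.
have EV : (fun p => slice_cc 0 t U p - slice_cc 0 s U p) = slice_oc s t U.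
  apply/funext => -[r w]; rewrite /slice_cc /slice_oc /=.
  have [sr|rs] := ltP s r.
    by rewrite andbF subr0 (le_trans s0 (ltW sr)).
  by rewrite (le_trans rs st) subrr.
rewrite EV in IX.
have [_ [mX _]] := ito_limit_L2 IX.
(* D is solved from the equation rather than taken as a time integral: it is then measurable by
   construction and the decomposition of [U t] holds at every w, while D agrees with the time
   integral almost everywhere. *)
pose D w : M := 2%:C *: (U s w + 'i *: (Xt w - Xs w) - U t w).
have mD : mxmeas D.
  apply: mxmeas_scale; apply: mxmeasB; last exact: ubm_mxmeas.
  by apply: mxmeasD; [exact: ubm_mxmeas|exact: mxmeas_scale].
exists (fun w => Xt w - Xs w), D; split=> //.
  move=> w; rewrite /D scalerA.
  rewrite (_ : (- 2^-1)%:C * 2%:C = -1); last first.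
    by apply/eqP; rewrite eq_complex /=; apply/andP; split; apply/eqP; field.
  by apply/matrixP => i j; rewrite !mxE; ring.
have h2 : (2%:C : R[i]) * (2^-1)%:C = 1.
  by apply/eqP; rewrite eq_complex /=; apply/andP; split; apply/eqP; field.
have alg (e j x y z v : R[i]) : 2%:C * (e + j * y - (2^-1)%:C * v + j * (x - y) -
    (e + j * x - (2^-1)%:C * z)) = z - v.
  by transitivity (2%:C * (2^-1)%:C * (z - v)); [ring|rewrite h2 mul1r].
apply: filterS2 es et => w es et; rewrite /D es et half_realC.
move: (time_integral t U w) (time_integral s U w) => Z V.
by apply/matrixP => i j; rewrite !mxE; exact: alg.
Qed.



(** The last bound is conditional on square integrability of [U s] because the case s = 0 of this
    lemma is what proves it, in [ubm_L2]. *)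
Lemma ubm_increment_bounds s t : 0 <= s -> s <= t ->
  exists DX D, [/\ ito_limit P F H (slice_oc s t U) DX, mxL2 P D,
    norm2_int P D <= (t - s) * norm2_int muP (slice_oc s t U),
    forall w, U t w = U s w + ('i *: DX w + (- 2^-1)%:C *: D w) &
    (mxL2 P (U s) -> norm2_int P (fun w => D w - (t - s)%:C *: U s w) <=
       (t - s) * norm2_int muP (slice_oc s t (fun r w => U r w - U s w)))].
Proof.
move=> s0 st; have [DX [D [IX mD eU eD]]] := ubm_increment s0 st.
have [LV LX] := ito_limit_L2 IX.
have [LD nD] : mxL2 P D /\ norm2_int P D <= (t - s) * norm2_int muP (slice_oc s t U).
  apply: ae_time_bound => //; apply: filterS eD => w ->.
  exact: time_integral_CS.
exists DX, D; split=> // LU.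
have LV' : mxL2 muP (slice_oc s t (fun r w => U r w - U s w)).
  rewrite (_ : slice_oc s t (fun r w => U r w - U s w) =
    (fun p => slice_oc s t U p - slice_oc s t (fun=> U s) p)); last first.
    by apply/funext => p; rewrite /slice_oc; case: ifP; rewrite ?subr0.
  by apply: mxL2B => //; exact: slice_oc_cst_L2.
have [] := @ae_time_bound _ _ _ P _ (fun w => D w - (t - s)%:C *: U s w) _ s t st _ LV' _ => //.
  by apply: mxmeasB => //; apply: mxmeas_scale; case: LU.
apply: filterS eD => w ->; exact: time_integral_remainder_CS.
Qed.

Lemma mxL2_cst (A : M) : mxL2 P (fun=> A).
Proof.
apply: (mxL2_le (f := fun=> hsnorm2 A)) => //.
exact: integrable_cstR.
Qed.

(** The integrand condition controls U only in the product space. At a fixed time, square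
    integrability comes from the two parts of U_t - I, which are square integrable as an Ito limit
    and by Cauchy-Schwarz in time. *)
Lemma ubm_L2 t : 0 <= t -> mxL2 P (U t).
Proof.
move=> t0; have [DX [D [IX LD _ eU _]]] := ubm_increment_bounds (lexx 0) t0.
have [_ LX] := ito_limit_L2 IX.
rewrite (_ : U t = (fun w => 1%:M + ('i *: DX w + (- 2^-1)%:C *: D w))).
  apply: mxL2D; first exact: mxL2_cst.
  by apply: mxL2D; [exact: mxL2_iZ|exact: mxL2Z].
by apply/funext => w; rewrite eU; case: hU => _ _ -> _.
Qed.

Lemma ubm_slice_oc_L2 s t : 0 <= s -> s <= t -> mxL2 muP (slice_oc s t U).
Proof.
by move=> s0 st; have [DX [D [/ito_limit_L2[]]]] := ubm_increment_bounds s0 st.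
Qed.

Lemma ubm_slice_oc_norm_mono s t u : 0 <= s -> s <= t -> t <= u ->
  norm2_int muP (slice_oc s t U) <= norm2_int muP (slice_oc s u U).
Proof.
move=> s0 st tu; apply: norm2_int_le.
- exact: ubm_slice_oc_L2.
- by apply: ubm_slice_oc_L2 => //; exact: le_trans tu.
- move=> p; rewrite /slice_oc; case: ifP => [/andP[sp pt]|_].
    by rewrite sp (le_trans pt tu).
  by rewrite hsnorm20 hsnorm2_ge0.
Qed.

Lemma ubm_increment_norm DX D (Us Ut : T -> M) : mxL2 P DX -> mxL2 P D ->
  (forall w, Ut w = Us w + ('i *: DX w + (- 2^-1)%:C *: D w)) ->
  norm2_int P (fun w => Ut w - Us w) <= 2 * norm2_int P DX + 2^-1 * norm2_int P D.
Proof.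
move=> LX LD eU.
rewrite (_ : (fun w => Ut w - Us w) = (fun w => 'i *: DX w + (- 2^-1)%:C *: D w)).
  apply: (le_trans (norm2_intD_le (mxL2_iZ LX) (mxL2Z _ LD))).
  rewrite norm2_int_iZ norm2_intZ// lerD2l mulrA ler_wpM2r ?norm2_int_ge0//.
  by rewrite le_eqVlt; apply/orP; left; apply/eqP; field.
by apply/funext => w; rewrite eU addrC addKr.
Qed.

(** Both parts of U_t - I are bounded through [J], the squared norm of U over ]0, tau] in the
    product space: the isometry gives J for DX, and Cauchy-Schwarz in time gives tau J for D. *)
Lemma ubm_norm_bound tau : 0 <= tau -> exists2 C, 0 <= C &
  forall t, 0 <= t -> t <= tau -> norm2_int P (U t) <= C.
Proof.
move=> tau0; pose J := norm2_int muP (slice_oc 0 tau U).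
have J0 : 0 <= J by exact: norm2_int_ge0.
exists (2 * (2 * J + 2^-1 * (tau * J)) + 2 * norm2_int P (fun=> 1%:M : M)).
  by rewrite addr_ge0 ?mulr_ge0 ?addr_ge0 ?mulr_ge0 ?norm2_int_ge0.
move=> t t0 tt; have [DX [D [IX LD nD eU _]]] := ubm_increment_bounds (lexx 0) t0.
have [_ LX] := ito_limit_L2 IX.
have U0 : U 0 = (fun=> 1%:M) by apply/funext => w; case: hU => _ _ -> _.
have LU0 : mxL2 P (U 0) by rewrite U0; exact: mxL2_cst.
have -> : U t = (fun w => (U t w - U 0 w) + U 0 w) by apply/funext => w; rewrite subrK.
have LUt := ubm_L2 t0.
apply: (le_trans (norm2_intD_le (mxL2B LUt LU0) LU0)).
rewrite -U0 lerD2r ler_wpM2l//.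
apply: (le_trans (ubm_increment_norm LX LD eU)).
have hJ : norm2_int muP (slice_oc 0 t U) <= J by exact: ubm_slice_oc_norm_mono.
rewrite lerD// ler_wpM2l//.
  by rewrite (ito_limit_norm hF hH hFH N0 IX).
apply: (le_trans nD); rewrite subr0 ler_pM// norm2_int_ge0//.
Qed.

(** The bounds are written as squares, with g the root of t - s, so that the order of a pairing is
    read off from the powers of g. The last one has a factor t - s from the increments and another
    from the length of the interval. *)
Lemma ubm_step_bounds tau : 0 <= tau -> exists2 c, 0 <= c &
  forall s t, 0 <= s -> s <= t -> t <= tau ->
  let g := Num.sqrt (t - s) in
  [/\ norm2_int P (U s) <= c ^+ 2,
      norm2_int muP (slice_oc s t U) <= (c * g) ^+ 2,
      norm2_int P (fun w => U t w - U s w) <= (c * g) ^+ 2 &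
      norm2_int muP (slice_oc s t (fun r w => U r w - U s w)) <= (c * g ^+ 2) ^+ 2].
Proof.
move=> tau0; have [C C0 hC] := ubm_norm_bound tau0.
pose C' := 2 * C + 2^-1 * (tau * C).
have C'0 : 0 <= C' by rewrite addr_ge0 ?mulr_ge0.
(* The summand 1 gives c <= c^2, so that c^2 dominates both C and C'. *)
pose c := 1 + C + C'.
have c1 : 1 <= c by rewrite /c; lra.
have cc : c <= c ^+ 2 by rewrite expr2 ler_peMl//; lra.
have Cc : C <= c ^+ 2 by apply: le_trans cc; rewrite /c; lra.
have C'c : C' <= c ^+ 2 by apply: le_trans cc; rewrite /c; lra.
have bV s t : 0 <= s -> s <= t -> t <= tau ->
    norm2_int muP (slice_oc s t U) <= C * (t - s).
  move=> s0 st tt; apply: slice_oc_norm_le => //; first exact: ubm_slice_oc_L2.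
  move=> r sr rt; have r0 : 0 <= r by rewrite (le_trans s0)// ltW.
  by split; [exact: ubm_L2|apply: hC => //; exact: le_trans tt].
have bD s t : 0 <= s -> s <= t -> t <= tau ->
    norm2_int P (fun w => U t w - U s w) <= C' * (t - s).
  move=> s0 st tt; have [DX [D [IX LD nD eU _]]] := ubm_increment_bounds s0 st.
  have [_ LX] := ito_limit_L2 IX; have h0 : 0 <= t - s by rewrite subr_ge0.
  apply: (le_trans (ubm_increment_norm LX LD eU)).
  have -> : C' * (t - s) = 2 * (C * (t - s)) + 2^-1 * (tau * (C * (t - s))).
    by rewrite /C'; ring.
  rewrite (ito_limit_norm hF hH hFH N0 IX) lerD// ler_wpM2l//.
    exact: bV.
  apply: (le_trans nD); apply: ler_pM; rewrite ?norm2_int_ge0//.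
    by rewrite (le_trans _ tt)// lerBlDr lerDl.
  exact: bV.
exists c; first by lra.
move=> s t s0 st tt g; have h0 : 0 <= t - s by rewrite subr_ge0.
have gg : g ^+ 2 = t - s by rewrite sqr_sqrtr.
have sU := ubm_L2 s0.
split.
- by apply: le_trans Cc; apply: hC => //; exact: le_trans tt.
- rewrite exprMn gg; apply: le_trans (bV _ _ s0 st tt) _.
  by rewrite ler_wpM2r.
- rewrite exprMn gg; apply: le_trans (bD _ _ s0 st tt) _.
  by rewrite ler_wpM2r.
- rewrite exprMn gg.
  apply: (@le_trans _ _ ((C' * (t - s)) * (t - s))); last first.
    by rewrite expr2 mulrA ler_wpM2r// ler_wpM2r.
  apply: (@slice_oc_norm_le _ _ _ P _ (fun r w => U r w - U s w)) => //.
  + by rewrite mulr_ge0.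
  + rewrite (_ : slice_oc s t (fun r w => U r w - U s w) =
      (fun p => slice_oc s t U p - slice_oc s t (fun=> U s) p)); last first.
      by apply/funext => p; rewrite /slice_oc; case: ifP; rewrite ?subr0.
    by apply: mxL2B; [exact: ubm_slice_oc_L2|exact: slice_oc_cst_L2].
  + move=> r sr rt; have r0 : 0 <= r by rewrite (le_trans s0)// ltW.
    split; first by apply: mxL2B => //; exact: ubm_L2.
    apply: (le_trans (bD _ _ s0 (ltW sr) (le_trans rt tt))).
    by rewrite ler_wpM2l// lerB.
Qed.

End UnitaryBrownianMotion.

(** * The one-step estimate and the exponential law *)

Section Estimate.
Context {d : measure_display} {T : measurableType d} {R : realType}.
Variable P : probability T R.
Context {N : nat}.
Local Notation M := 'M[R[i]]_N.
Variables (F : R -> set (set T)) (H U : R -> T -> M).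
Hypothesis hF : filtration F.
Hypothesis hH : hermitian_brownian_motion P H.
Hypothesis hFH : brownian_relative_to P F H.
Hypothesis hU : unitary_brownian_motion P F H U.
Hypothesis N0 : (0 < N)%N.

Local Notation mu := (@lebesgue_measure R).
Local Notation ST := (measurableTypeR R * T)%type.
Local Notation muP := (mu \x P)%E.

(** In the notation of the overview this is q, and p when [A] is the identity. *)
Definition ubm_form psi A (t : R) : R := form_int P (cform psi A) (U t) (U t).

(** Absorbs the factor i into the form, so that orthogonality, proved for DX, applies to i DX. *)
Lemma cform_iZr_rbilinear psi (A : M) : rbilinear (fun X Y => cform psi A X ('i *: Y)).
Proof.
have [h1 h2 h3 h4] := cform_rbilinear psi A.
split=> [X Y Z|r X Y|X Y Z|r X Y] //; first by rewrite scalerDr h3.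
by rewrite scalerA mulrC -scalerA h4.
Qed.

Lemma form_int_square_expand (b : M -> M -> R) (X Y Z : T -> M) (r : R) :
  rbilinear b -> mxL2 P X -> mxL2 P Y -> mxL2 P Z ->
  form_int P b (fun w => X w + (Y w + r%:C *: Z w)) (fun w => X w + (Y w + r%:C *: Z w)) =
  form_int P b X X + (form_int P b X Y + r * form_int P b X Z) +
  (form_int P b Y X + r * form_int P b Z X +
   (form_int P b Y Y + r * form_int P b Y Z +
    r * (form_int P b Z Y + r * form_int P b Z Z))).
Proof.
move=> hb LX LY LZ.
have LrZ : mxL2 P (fun w => r%:C *: Z w) by exact: mxL2Z.
have LS : mxL2 P (fun w => Y w + r%:C *: Z w) by exact: mxL2D.
have LXS : mxL2 P (fun w => X w + (Y w + r%:C *: Z w)) by exact: mxL2D.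
have E (Q : T -> M) : mxL2 P Q -> form_int P b Q (fun w => X w + (Y w + r%:C *: Z w)) =
    form_int P b Q X + (form_int P b Q Y + r * form_int P b Q Z).
  move=> LQ; rewrite (form_intDr hb LQ LX LS) (form_intDr hb LQ LY LrZ).
  by rewrite (form_intZr hb _ LQ LZ).
rewrite (form_intDl hb LX LS LXS) (form_intDl hb LY LrZ LXS) (form_intZl hb _ LZ LXS).
rewrite !E//.
move: (form_int P b X X) (form_int P b X Y) (form_int P b X Z) (form_int P b Y X)
 (form_int P b Y Y) (form_int P b Y Z) (form_int P b Z X) (form_int P b Z Y) => *; ring.
Qed.

Lemma ubm_form_step psi A tau : A \is hermsymmx -> 0 <= tau ->
  exists K, forall s t, 0 <= s -> s <= t -> t <= tau ->
    `|ubm_form psi A t - ubm_form psi A s +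
      (t - s) * (ubm_form psi A s - normalized_trace A * ubm_form psi 1%:M s)| <=
    K * ((t - s) * Num.sqrt (t - s)).
Proof.
move=> hA tau0; have [c c0 hc] := ubm_step_bounds hF hH hFH hU N0 tau0.
have hb := cform_rbilinear psi A; have hb1 := cform_rbilinear psi 1%:M.
have [Kb Kb0 hKb] : exists2 K, 0 <= K & 2 * form_bound (cform psi A) = K.
  by exists (2 * form_bound (cform psi A)); rewrite ?mulr_ge0 ?form_bound_ge0.
have [K1 K10 hK1] : exists2 K, 0 <= K & 2 * form_bound (cform psi (1%:M : M)) = K.
  by exists (2 * form_bound (cform psi (1%:M : M))); rewrite ?mulr_ge0 ?form_bound_ge0.
(* One summand per error term of [key], in that order; the last carries the root of tau because <D,
   D> is of order h^2. *)
exists (Kb * c ^+ 2 + `|normalized_trace A| * (K1 * (2 * c ^+ 2)) + Kb * c ^+ 2 +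
  4^-1 * (Kb * c ^+ 2 * Num.sqrt tau)) => s t s0 st tt.
have [] := hc s t s0 st tt; set g := Num.sqrt (t - s) => nU nV nDel nVW.
have h0 : 0 <= t - s by rewrite subr_ge0.
have g0 : 0 <= g by exact: sqrtr_ge0.
have gg : g ^+ 2 = t - s by rewrite sqr_sqrtr.
have LU := ubm_L2 hF hH hFH hU N0 s0.
have [DX [D [IX LD nD eU nE]]] := ubm_increment_bounds hF hH hFH hU N0 s0 st.
move/(_ LU) in nE; have [LV LX] := ito_limit_L2 IX.
pose Mt w := 'i *: DX w; pose E w := D w - (t - s)%:C *: U s w.
have LM : mxL2 P Mt by exact: mxL2_iZ.
have LE : mxL2 P E by apply: mxL2B => //; exact: mxL2Z.
(* [W] is the integrand frozen at time s, and [VW] the error of freezing it. *)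
pose V := slice_oc s t U; pose W : ST -> M := slice_oc s t (fun=> U s).
pose VW : ST -> M := slice_oc s t (fun r w => U r w - U s w).
have LW : mxL2 muP W by exact: slice_oc_cst_L2.
have EVW : VW = (fun p => V p - W p).
  by apply/funext => p; rewrite /VW /V /W /slice_oc; case: ifP; rewrite ?subr0.
have LVW : mxL2 muP VW by rewrite EVW; exact: mxL2B.
have nM : norm2_int P Mt <= (c * g) ^+ 2.
  by rewrite norm2_int_iZ (ito_limit_norm hF hH hFH N0 IX).
have nD' : norm2_int P D <= (c * g ^+ 2) ^+ 2.
  apply: (le_trans nD); rewrite (_ : (c * g ^+ 2) ^+ 2 = g ^+ 2 * (c * g) ^+ 2); last by ring.
  by rewrite gg ler_wpM2l.
have nE' : norm2_int P E <= (c * g ^+ 3) ^+ 2.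
  apply: (le_trans nE).
  rewrite (_ : (c * g ^+ 3) ^+ 2 = g ^+ 2 * (c * g ^+ 2) ^+ 2); last by ring.
  by rewrite [X in _ <= X * _]gg ler_wpM2l.
have nW : norm2_int muP W <= (c * g) ^+ 2.
  rewrite exprMn gg; apply: (@slice_oc_norm_le _ _ _ P _ (fun=> U s)) => //.
  exact: sqr_ge0.
have uM : form_int P (cform psi A) (U s) Mt = 0.
  apply: (ito_limit_orthogonal hF hH hFH N0 (cform_iZr_rbilinear psi A) IX s0) => //.
    by move=> p ps; rewrite /slice_oc ltNge (ltW ps).
  exact: (ubm_adapted hU s0).
have MM : form_int P (cform psi A) Mt Mt = normalized_trace A * form_int muP (cform psi 1%:M) V V.
  rewrite -(ito_limit_isometry hF hH hFH N0 _ hA IX).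
  by apply: eq_Rintegral => w _; rewrite cformiZ.
have WW : form_int muP (cform psi 1%:M) W W = (t - s) * ubm_form psi 1%:M s.
  exact: form_int_slice_oc_cst.
have VV : form_int muP (cform psi 1%:M) V V = (t - s) * ubm_form psi 1%:M s +
   (form_int muP (cform psi 1%:M) VW V + form_int muP (cform psi 1%:M) W VW).
  rewrite -WW EVW (form_intBl hb1 LV LW LV) (form_intBr hb1 LW LV LW).
  move: (form_int _ _ V V) (form_int _ _ W V) (form_int _ _ W W) => x y z; ring.
have uE : form_int P (cform psi A) (U s) E =
    form_int P (cform psi A) (U s) D - (t - s) * ubm_form psi A s.
  by rewrite (form_intBr hb LU LD (mxL2Z _ LU)) (form_intZr hb _ LU LU).
(* In the expanded square, U_s against the martingale part gives 0; U_s against -D/2 occurs twice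
   and gives -(t - s) q(s) minus the pairing with E; the martingale square gives the drift up to the
   freezing error. *)
have key : ubm_form psi A t - ubm_form psi A s +
    (t - s) * (ubm_form psi A s - normalized_trace A * ubm_form psi 1%:M s) =
  - form_int P (cform psi A) (U s) E +
  normalized_trace A * (form_int muP (cform psi 1%:M) VW V + form_int muP (cform psi 1%:M) W VW) +
  - form_int P (cform psi A) Mt D + 4^-1 * form_int P (cform psi A) D D.
  have -> : ubm_form psi A t = form_int P (cform psi A)
      (fun w => U s w + (Mt w + (- 2^-1)%:C *: D w))
      (fun w => U s w + (Mt w + (- 2^-1)%:C *: D w)).
    have eU' : U t = (fun w => U s w + (Mt w + (- 2^-1)%:C *: D w)) by exact/funext.
    by rewrite /ubm_form -eU'.
  have Mu := form_int_sym P psi Mt (U s) hA.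
  have Du := form_int_sym P psi D (U s) hA.
  have DM := form_int_sym P psi D Mt hA.
  have := form_int_square_expand (- 2^-1) hb LU LM LD.
  rewrite Mu Du DM uM MM VV => ->; rewrite uE -/(ubm_form psi A s).
  move: (form_int muP _ VW V) (form_int muP _ W VW) (form_int P _ Mt D)
    (form_int P _ D D) (form_int P _ (U s) D) => x1 x2 x3 x4 x5.
  move: (ubm_form psi A s) (ubm_form psi 1%:M s) (normalized_trace A) => x6 x7 x8; by field.
rewrite key.
have b1 := form_int_le hb LU LE c0 (mulr_ge0 c0 (exprn_ge0 3 g0)) nU nE'.
have b2 := form_int_le hb1 LVW LV (mulr_ge0 c0 (exprn_ge0 2 g0)) (mulr_ge0 c0 g0) nVW nV.
have b3 := form_int_le hb1 LW LVW (mulr_ge0 c0 g0) (mulr_ge0 c0 (exprn_ge0 2 g0)) nW nVW.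
have b4 := form_int_le hb LM LD (mulr_ge0 c0 g0) (mulr_ge0 c0 (exprn_ge0 2 g0)) nM nD'.
have b5 := form_int_le hb LD LD
  (mulr_ge0 c0 (exprn_ge0 2 g0)) (mulr_ge0 c0 (exprn_ge0 2 g0)) nD' nD'.
rewrite hKb in b1 b4 b5; rewrite hK1 in b2 b3.
have gt : g <= Num.sqrt tau.
  by rewrite ler_sqrt// (le_trans _ tt)// lerBlDr lerDl.
rewrite -gg !mulrDl.
apply: (le_trans (ler_normD _ _)); apply: lerD; last first.
  rewrite normrM ger0_norm// -!mulrA ler_wpM2l//; apply: (le_trans b5).
  (* Of the four powers of g one is bounded by the root of tau, to match the common factor g^3. *)
  rewrite (_ : Kb * (c * g ^+ 2 * (c * g ^+ 2)) = Kb * c ^+ 2 * (g ^+ 3) * g); last by ring.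
  rewrite [leRHS](_ : _ = Kb * c ^+ 2 * g ^+ 3 * Num.sqrt tau); last by ring.
  by rewrite ler_wpM2l// mulr_ge0 ?exprn_ge0// mulr_ge0 ?sqr_ge0.
apply: (le_trans (ler_normD _ _)); apply: lerD; last first.
  by rewrite normrN (le_trans b4)// le_eqVlt; apply/orP; left; apply/eqP; ring.
apply: (le_trans (ler_normD _ _)); apply: lerD.
  by rewrite normrN (le_trans b1)// le_eqVlt; apply/orP; left; apply/eqP; ring.
rewrite normrM -!mulrA ler_wpM2l//; apply: (le_trans (ler_normD _ _)).
apply: (le_trans (lerD b2 b3)).
by rewrite le_eqVlt; apply/orP; left; apply/eqP; ring.
Qed.

(** Over n equal steps the changes add up to at most K tau^(3/2) / sqrt n. A nonzero total change
    [del] would thus keep del sqrt n bounded by L, which fails for n beyond (L / del)^2. *)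
Lemma Holder_const (f : R -> R) (tau K : R) : 0 <= tau ->
  (forall s t, 0 <= s -> s <= t -> t <= tau ->
     `|f t - f s| <= K * ((t - s) * Num.sqrt (t - s))) -> f tau = f 0.
Proof.
move=> tau0 hf; apply/eqP; rewrite -subr_eq0 -normr_eq0.
set del := `|f tau - f 0|.
apply: contraT => del0; have {}del0 : 0 < del by rewrite lt_neqAle eq_sym del0 normr_ge0.
pose L := K * (tau * Num.sqrt tau).
have step (n : nat) : del * Num.sqrt n.+1%:R <= L.
  have n0 : 0 < n.+1%:R :> R by rewrite ltr0n.
  have n1 : n.+1%:R != 0 :> R by rewrite gt_eqF.
  pose h := tau / n.+1%:R.
  have h0 : 0 <= h by rewrite divr_ge0// ltW.
  have hn : n.+1%:R * h = tau by rewrite /h; field.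
  have part k : (k <= n.+1)%N -> `|f (k%:R * h) - f 0| <= k%:R * (K * (h * Num.sqrt h)).
    elim: k => [|k IH] hk; first by rewrite !mul0r subrr normr0.
    have e : k.+1%:R * h - k%:R * h = h by rewrite -natr1; ring.
    have le1 := hf (k%:R * h) (k.+1%:R * h).
    rewrite e in le1.
    have -> : f (k.+1%:R * h) - f 0 =
       (f (k.+1%:R * h) - f (k%:R * h)) + (f (k%:R * h) - f 0) by ring.
    apply: (le_trans (ler_normD _ _)); rewrite -[in X in _ <= X]natr1 mulrDl mul1r addrC.
    rewrite lerD ?IH ?(ltnW hk)//; apply: le1.
    - by rewrite mulr_ge0.
    - by rewrite ler_wpM2r// ler_nat.
    - by rewrite -hn ler_wpM2r// ler_nat.
  have := part n.+1 (leqnn _); rewrite hn -/del => le.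
  have sn : Num.sqrt h * Num.sqrt n.+1%:R = Num.sqrt tau.
    by rewrite -sqrtrM// mulrC hn.
  apply: (le_trans (ler_wpM2r (sqrtr_ge0 _) le)).
  rewrite le_eqVlt; apply/orP; left; apply/eqP.
  rewrite /L -{1}hn -sn; ring.
pose n := Num.truncn ((L / del) ^+ 2).
have := step n; rewrite leNgt => /negP; case.
have lt : (L / del) ^+ 2 < n.+1%:R.
  by have /andP[] := truncn_itv (sqr_ge0 (L / del)).
rewrite -ltr_pdivrMl// mulrC (le_lt_trans (ler_norm _))// -sqrtr_sqr ltr_sqrt//.
Qed.

Lemma ubm_form0 psi A : ubm_form psi A 0 = complex.Re (cdot psi (A *m psi)).
Proof.
rewrite /ubm_form /form_int.
rewrite (@eq_Rintegral _ _ _ _ _ (fun=> complex.Re (cdot psi (A *m psi)))); last first.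
  by move=> w _; case: hU => _ _ -> _; rewrite /cform mul1mx.
by rewrite Rintegral_cst//= probability_setT mulr1.
Qed.

Lemma ubm_form_norm psi t : cdot psi psi = 1 -> 0 <= t -> ubm_form psi 1%:M t = 1.
Proof.
move=> psi1 t0; have [K hK] := ubm_form_step psi herm_mx1 t0.
have -> : ubm_form psi 1%:M t = ubm_form psi 1%:M 0.
  apply: (Holder_const (f := ubm_form psi 1%:M) (K := K) t0) => s u s0 su ut.
  have z : (u - s) * (ubm_form psi 1%:M s - normalized_trace (1%:M : M) * ubm_form psi 1%:M s) = 0.
    by rewrite (normalized_trace1 N0); move: (ubm_form psi 1%:M s) => x; ring.
  by move: (hK s u s0 su ut); rewrite z addr0.
by rewrite ubm_form0 mul1mx psi1.
Qed.

(** Both sides come from 1 + x <= e^x: at -h it is the lower bound, and at h it gives e^(-h) <= 1 /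
    (1 + h), which is at most 1 - h + h^2 since (1 - h + h^2)(1 + h) = 1 + h^3. *)
Lemma expRN_remainder (h : R) : 0 <= h -> `|expR (- h) - 1 + h| <= h ^+ 2.
Proof.
move=> h0; have l := expR_ge1Dx (- h); have u := expR_ge1Dx h.
have h1 : 0 < 1 + h by lra.
have e : expR (- h) * expR h = 1 by rewrite -expRD addNr expR0.
have e0 : 0 < expR (- h) by exact: expR_gt0.
have le1 : expR (- h) * (1 + h) <= 1 by rewrite -[leRHS]e ler_wpM2l// ltW.
have le2 : 1 <= (1 - h + h ^+ 2) * (1 + h).
  have := exprn_ge0 3 h0.
  rewrite (_ : (1 - h + h ^+ 2) * (1 + h) = 1 + h ^+ 3); last by ring.
  by move=> h3; rewrite lerDl.
have : expR (- h) <= 1 - h + h ^+ 2.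
  by rewrite -(ler_pM2r h1) (le_trans le1 le2).
by move=> le3; rewrite ger0_norm; lra.
Qed.

Lemma ubm_formE psi A t : cdot psi psi = 1 -> A \is hermsymmx -> 0 <= t ->
  ubm_form psi A t = (ubm_form psi A 0 - normalized_trace A) * expR (- t) + normalized_trace A.
Proof.
move=> psi1 hA t0; have [K hK] := ubm_form_step psi hA t0.
have [c c0 hc] := ubm_step_bounds hF hH hFH hU N0 t0.
(* [G] bounds q - k uniformly on [0, t]; it multiplies the error made by the exponential factor. *)
set k := normalized_trace A; pose G := 2 * form_bound (cform psi A) * (c * c) + `|k|.
have hG s : 0 <= s -> s <= t -> `|ubm_form psi A s - k| <= G.
  move=> s0 st; have LU := ubm_L2 hF hH hFH hU N0 s0.
  have [nU _ _ _] := hc s t s0 st (lexx t).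
  rewrite (le_trans (ler_normB _ _))// lerD2r.
  exact: (form_int_le (cform_rbilinear psi A) LU LU c0 c0 nU nU).
pose f s := expR s * (ubm_form psi A s - k).
have : f t = f 0.
  apply: (Holder_const (K := expR t * (K + G * Num.sqrt t))) => // s u s0 su ut.
  have u0 : 0 <= u by exact: le_trans su.
  have h0 : 0 <= u - s by rewrite subr_ge0.
  have st : s <= t by exact: le_trans ut.
  set h := u - s; set g := Num.sqrt h.
  (* From e^s = e^u e^(-h): the first bracket is the step estimate with p(s) = 1, the second the
     Taylor remainder of the exponential, of order h^2. *)
  have -> : f u - f s = expR u * ((ubm_form psi A u - ubm_form psi A s +
      h * (ubm_form psi A s - k)) - (expR (- h) - 1 + h) * (ubm_form psi A s - k)).
    have es : expR s = expR u * expR (- h) by rewrite -expRD /h; congr expR; ring.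
    rewrite /f es; move: (ubm_form psi A u) (ubm_form psi A s) (expR u) (expR (- h)).
    by move=> *; ring.
  rewrite normrM ger0_norm ?expR_ge0// -mulrA.
  apply: ler_pM => //; rewrite ?expR_ge0 ?ler_expR//.
  apply: (le_trans (ler_normB _ _)); rewrite [leRHS]mulrDl; apply: lerD.
    have := hK s u s0 su ut; rewrite ubm_form_norm// mulr1 => le.
    exact: le.
  rewrite normrM mulrC.
  apply: (@le_trans _ _ (G * h ^+ 2)).
    by apply: ler_pM => //; [exact: hG|exact: expRN_remainder].
  rewrite -mulrA ler_wpM2l//.
    by rewrite addr_ge0 ?mulr_ge0 ?form_bound_ge0.
  have gg : g ^+ 2 = h by rewrite sqr_sqrtr.
  rewrite (_ : Num.sqrt t * (h * g) = h * (g * Num.sqrt t)); last by ring.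
  rewrite expr2 ler_wpM2l// -[leLHS]gg expr2 ler_wpM2l ?sqrtr_ge0//.
  by rewrite ler_sqrt// (le_trans _ ut)// /h lerBlDr lerDl.
rewrite /f expR0 mul1r => ft.
have e : expR (- t) * expR t = 1 by rewrite -expRD addNr expR0.
rewrite -ft; move: (ubm_form psi A t) => x.
rewrite (_ : expR t * (x - k) * expR (- t) = expR (- t) * expR t * (x - k)); last by ring.
by rewrite e mul1r subrK.
Qed.

End Estimate.

Theorem lemma5p4 (R : realType) (d : measure_display) (T : measurableType d)
    (P : probability T R) (N : nat)
    (F : R -> set (set T)) (H U : R -> T -> 'M[R[i]]_N)
    (psi : 'cV[R[i]]_N) (A : 'M[R[i]]_N) :
  filtration F ->
  hermitian_brownian_motion P H ->
  brownian_relative_to P F H ->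
  unitary_brownian_motion P F H U ->
  cdot psi psi = 1 ->
  A \is hermsymmx ->
  forall t : R, 0 <= t ->
    let psi_t := fun w : T => U t w *m psi in
    complex_integrable P (fun w => cdot (psi_t w) (A *m psi_t w)) /\
    complex_expectation P (fun w => cdot (psi_t w) (A *m psi_t w)) =
      (cdot psi (A *m psi) - \tr A / N%:R) * (expR (- t))%:C + \tr A / N%:R.
Proof.
move=> hF hH hFH hU psi1 hA t t0 psi_t.
(* For N = 0 the inner product is an empty sum, which contradicts |psi| = 1. *)
have N0 : (0 < N)%N.
  case: (posnP N) => // N0; move: psi1; rewrite cdotE big1.
    by move/eqP; rewrite eq_sym oner_eq0.
  by case=> i iN; exfalso; rewrite N0 in iN.
have LU := ubm_L2 hF hH hFH hU N0 t0.
(* As [A] is Hermitian, the complex expectation reduces to its real part, which is [ubm_form]. *)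
have Im0 w : complex.Im (cdot (psi_t w) (A *m psi_t w)) = 0 by exact: cdot_Im.
split.
  split; first exact: (mxL2_form (cform_rbilinear psi A) LU LU).
  apply: (eq_integrable _ (cst 0%E)) => //; last exact: integrable0.
  by move=> w _; rewrite Im0.
have trA : \tr A / N%:R = (normalized_trace A)%:C.
  have : complex.Im (\tr A) = 0 by exact: herm_trace_Im.
  rewrite /normalized_trace; case: (\tr A) => x y /= ->.
  have NC : N%:R = (N%:R : R)%:C by rewrite rmorph_nat.
  by rewrite NC; exact/esym/fmorph_div.
have q0 : cdot psi (A *m psi) = (ubm_form P U psi A 0)%:C.
  rewrite (ubm_form0 hU); have := cdot_Im psi 1%:M hA.
  by rewrite mul1mx; case: (cdot _ _) => x y /= ->.
rewrite trA q0 /complex_expectation unlock.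
have -> : fine (\int[P]_w (complex.Re (cdot (psi_t w) (A *m psi_t w)))%:E)%E =
   ubm_form P U psi A t by [].
under [X in _ +i* fine X]eq_integral do rewrite Im0.
rewrite integral0 (ubm_formE hF hH hFH hU N0 psi1 hA t0).
move: (ubm_form P U psi A 0) (normalized_trace A) (expR (- t)) => x y z.
by apply/eqP; rewrite eq_complex /= !(mul0r, mulr0, oppr0, addr0, subr0) !eqxx.
Qed.
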